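(* Let $m,n\in\mathbb{N}$ and let $A$ be a bounded $p$-hyponormal operator on a complex Hilbert space with $p\in(m-1,m]$. If $(A^* )^nA^n=(A^*A)^n$ and $n\geq m+3$, then $A$ is quasinormal. Moreover, if $A$ is a bounded hyponormal operator and $(A^* )^kA^k=(A^*A)^k$ for some integer $k\geq 2$, then $A$ is quasinormal.
   Context: $\mathbb{N}$ denotes the set of positive integers. For a real number $p>0$, a bounded operator $A$ is called $p$-hyponormal if $(A^*A)^p\geq(AA^* )^p$; hyponormal means $1$-hyponormal. A bounded operator $A$ is called quasinormal if $A(A^*A)=(A^*A)A$. *)

(* Defs.v *)
From mathcomp Require Export all_boot all_order all_algebra.
From mathcomp Require Export complex.
From mathcomp Require Export all_classical all_reals all_analysis.
Export numFieldNormedType.Exports.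
Export Order.TTheory GRing.Theory Num.Theory.

Set Implicit Arguments.
Unset Strict Implicit.
Unset Printing Implicit Defensive.

#[export] Set Implicit Arguments.
#[export] Unset Strict Implicit.
#[export] Unset Printing Implicit Defensive.

Global Open Scope classical_set_scope.
Global Open Scope complex_scope.
Global Open Scope ring_scope.

Section Operators.
Variables (R : realType) (V : completeNormedModType R[i]).

Definition hilbert_norm (dot : {dot V for Num.Def.conjC}) : Prop :=
  forall x : V, `|x| ^+ 2 = dot x x.

Definition bounded_op (A : V -> V) : Prop :=
  exists M : R, forall x, `|A x| <= M%:C * `|x|.

(* Only meaningful when A is bounded: otherwise inf ranges over the empty
   set and returns 0. *)
Definition opnorm (A : V -> V) : R :=
  inf [set M : R | 0 <= M /\ forall x, `|A x| <= M%:C * `|x|].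

Definition op_poly (q : {poly R}) (T : V -> V) : V -> V :=
  fun x => \sum_(i < size q) (q`_i)%:C *: iter i T x.

(* Convergence in the operator norm, written out without opnorm: as opnorm is
   0 on unbounded maps, opnorm (S k - T) --> 0 would admit junk limits. *)
Definition op_cvg (S : nat -> V -> V) (T : V -> V) : Prop :=
  forall e : R, 0 < e ->
    \forall k \near \oo, forall x, `|S k x - T x| <= e%:C * `|x|.

(* Continuous functional calculus of a positive bounded operator T, whose
   spectrum lies in [0, |T|]: f(T) is the norm limit of q_k(T) for polynomials
   q_k converging to f uniformly on that interval. *)
Definition is_fun_calc (f : R -> R) (T S : V -> V) : Prop :=
  exists q : nat -> {poly R},
    {uniform `[0, opnorm T], (fun k => horner (q k)) @ \oo --> f} /\
    op_cvg (fun k => op_poly (q k) T) S.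

(* T^p for T positive and bounded; for p > 0 such a limit exists (Weierstrass)
   and is unique. *)
Definition op_pow (p : R) (T : V -> V) : V -> V :=
  xget (fun=> 0) [set S | is_fun_calc (fun t => t `^ p) T S].

Variable dot : {dot V for Num.Def.conjC}.

(* For A linear and bounded the adjoint exists (Riesz) and is unique. *)
Definition adjoint (A : V -> V) : V -> V :=
  xget (fun=> 0) [set B | forall x y, dot (A x) y = dot x (B y)].

Definition op_le (S T : V -> V) : Prop :=
  forall x, 0 <= dot (T x - S x) x.

Definition p_hyponormal (p : R) (A : V -> V) : Prop :=
  op_le (op_pow p (A \o adjoint A)) (op_pow p (adjoint A \o A)).

Definition hyponormal (A : V -> V) : Prop := p_hyponormal 1 A.

Definition quasinormal (A : V -> V) : Prop :=
  A \o (adjoint A \o A) = (adjoint A \o A) \o A.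

End Operators.

(* Main.v *)
Require Import Defs.
From HB Require Import structures.
From mathcomp Require Import zify ring lra.

(* Write P = A^* A, Q = A A^* and S_j = (A^* )^j A^j. Since t^(1/2) is operator
   monotone, p-hyponormality is inherited by p/2, so p <= 1 may be assumed;
   the tangent lines of t^p and t^(p+1) then show that A is paranormal:
   2 l |A x|^2 <= |A^2 x|^2 + l^2 |x|^2 for every l > 0. Hence the sequence
   k |-> |A^k x|^2 / l^k is convex, which bounds S_j from below by the tangent of
   t^j at l evaluated at P, and, given S_n = P^n, from above by a function of P
   touching t^j to second order at l. Letting l run over the spectrum of P, the
   error D = S_j - P^j (times a power of P) is Lipschitz-small near each
   spectral point, and an operator with this property vanishes: cut x into N
   pieces of spectral width 1/N, each contributing O(1/N) of its own norm, so
   that Cauchy-Schwarz leaves O(N^(-1/2)). Thus S_j = P^j for j <= n, and S_2 = P^2,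
   S_3 = P^3 give |P A x - A P x|^2 = 0. When A is hyponormal and S_2 = P^2,
   A^* (P - Q) A = 0 with P - Q >= 0 already yields P A = Q A = A P. *)

(** * The real inner product *)

(** Spectral projections are replaced by polynomials in P, and D need not commute with P. A bound on
    the form <D y, y> near a spectral point l is therefore not enough: the vector bound |D y| <= C
    |(P - l) y| is required. It comes from a squeeze. S_j minus its tangent bound at l is a positive
    operator whose form is O(|(P - l) y|^2), and Cauchy-Schwarz for positive forms turns this into a
    bound on the image vector. The step costs a square root, which is why contact to second order is
    needed. The images of the spectral pieces are not orthogonal, so their norms are summed by the
    triangle inequality.

    Convexity is available only after division by l^k, so the upper half of the squeeze carries a
    weight l^m and degenerates as l tends to 0. This is the origin of the power of P multiplying D;
    it is removed at the end because P^m and A have compatible kernels.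

    Positivity of q(T) for q >= 0 on [0, M] rests on splitting polynomials over the complex
    numbers. *)

Section RealStructure.
Variables (R : realType) (H : completeNormedModType R[i]).
Variables (dot : {dot H for Num.Def.conjC}) (Hdot : hilbert_norm dot).

(** Estimates need only the real inner product, which has the same norm; [rip_dot] leads back to
    [dot]. *)
Definition redot (x y : H) : R := complex.Re (dot x y).
Local Notation rip := redot.

(** The norm of [H] takes values in [R[i]]; this is its real counterpart. *)
Definition rnorm (x : H) : R := complex.Re `|x|.

Lemma ReD (a b : R[i]) : complex.Re (a + b) = complex.Re a + complex.Re b.
Proof. by case: a b => [? ?] [? ?]. Qed.

Lemma ReN (a : R[i]) : complex.Re (- a) = - complex.Re a.
Proof. by case: a. Qed.

Lemma ReZ (c : R) (a : R[i]) : complex.Re (c%:C * a) = c * complex.Re a.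
Proof. by case: a => a b /=; rewrite mul0r subr0. Qed.

Lemma conjCE (a : R[i]) : Num.conj a = conjc a.
Proof. by case: a. Qed.

Lemma rnormE x : `|x| = (rnorm x)%:C.
Proof.
rewrite /rnorm; have : 0 <= `|x| by exact: normr_ge0.
by move: `|x| => -[a b]; rewrite lecE /= => /andP[/eqP-> _].
Qed.

Lemma rnorm_ge0 x : 0 <= rnorm x.
Proof. by rewrite -ler0c -rnormE normr_ge0. Qed.

Lemma dotC x y : dot x y = conjc (dot y x).
Proof. by rewrite hermC /= expr0 mul1r conjCE. Qed.

Lemma ripC x y : rip x y = rip y x.
Proof. by rewrite /redot dotC; case: (dot y x). Qed.

Lemma ripDl x y z : rip (x + y) z = rip x z + rip y z.
Proof. by rewrite /redot linearDl /= ReD. Qed.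

Lemma ripDr x y z : rip z (x + y) = rip z x + rip z y.
Proof. by rewrite !(ripC z) ripDl. Qed.

Lemma ripNl x z : rip (- x) z = - rip x z.
Proof. by rewrite /redot linearNl /= ReN. Qed.

Lemma ripNr x z : rip z (- x) = - rip z x.
Proof. by rewrite !(ripC z) ripNl. Qed.

Lemma ripZl (c : R) x z : rip (c%:C *: x) z = c * rip x z.
Proof. by rewrite /redot linearZl_LR /= ReZ. Qed.

Lemma ripZr (c : R) x z : rip z (c%:C *: x) = c * rip z x.
Proof. by rewrite !(ripC z) ripZl. Qed.

Lemma rip0l x : rip 0 x = 0.
Proof. by rewrite /redot linear0l. Qed.

Lemma rip0r x : rip x 0 = 0.
Proof. by rewrite ripC rip0l. Qed.

Definition ripE := (ripDl, ripDr, ripNl, ripNr, ripZl, ripZr).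

Lemma ripxx x : rip x x = rnorm x ^+ 2.
Proof. by rewrite /redot -Hdot rnormE -rmorphXn. Qed.

Lemma rip_ge0 x : 0 <= rip x x.
Proof. by rewrite ripxx sqr_ge0. Qed.

Lemma rnorm0 : rnorm 0 = 0. Proof. by rewrite /rnorm normr0. Qed.

Lemma rnorm_eq0 x : (rnorm x == 0) = (x == 0).
Proof. by rewrite -(inj_eq (@complexI R)) -rnormE normr_eq0. Qed.

Lemma rip_eq0 x : rip x x = 0 -> x = 0.
Proof. by rewrite ripxx => /eqP; rewrite sqrf_eq0 rnorm_eq0 => /eqP. Qed.

Lemma rnormD x y : rnorm (x + y) <= rnorm x + rnorm y.
Proof. by rewrite -lecR rmorphD /= -!rnormE ler_normD. Qed.

Lemma rnormN x : rnorm (- x) = rnorm x.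
Proof. by rewrite /rnorm normrN. Qed.

Lemma rnormB x y : rnorm (x - y) <= rnorm x + rnorm y.
Proof. by rewrite -(rnormN y) rnormD. Qed.

Lemma rnormC x y : rnorm (x - y) = rnorm (y - x).
Proof. by rewrite -rnormN opprB. Qed.

Lemma rnormZ (c : R) x : rnorm (c%:C *: x) = `|c| * rnorm x.
Proof.
apply/eqP; rewrite -(inj_eq (@complexI R)) rmorphM /= -!rnormE normrZ.
by rewrite [`|c%:C|]normc_def /= expr0n addr0 sqrtr_sqr.
Qed.

Lemma rnorm_sum (I : Type) (r : seq I) (F : I -> H) :
  rnorm (\sum_(i <- r) F i) <= \sum_(i <- r) rnorm (F i).
Proof.
elim/big_ind2: _ => [|x a y b xa yb|//]; first by rewrite rnorm0.
by rewrite (le_trans (rnormD _ _)) // lerD.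
Qed.

Lemma discr_le (a b c : R) : 0 <= c ->
  (forall s, 0 <= a - 2 * s * b + s ^+ 2 * c) -> b ^+ 2 <= a * c.
Proof.
move=> c0 h; have [c1|] := ltP 0 c.
  have := h (b / c); rewrite -(ler_pM2r c1) mul0r => h1.
  rewrite -subr_ge0; apply: le_trans h1 _.
  by rewrite le_eqVlt; apply/orP; left; apply/eqP; field; rewrite gt_eqF.
move=> c1; have {c0 c1} c0 : c = 0 by apply: le_anti; rewrite c1.
rewrite c0 mulr0; have [->|b0] := eqVneq b 0; first by rewrite expr0n.
(* For c = 0 the form is affine in s, and this s gives it the value -1. *)
have := h ((a + 1) / (2 * b)); rewrite c0 mulr0 addr0.
have -> : a - 2 * ((a + 1) / (2 * b)) * b = - 1 by field.
by rewrite oppr_ge0 ler10.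
Qed.

Lemma rip_CS x y : rip x y ^+ 2 <= rip x x * rip y y.
Proof.
apply: discr_le => [|s]; first exact: rip_ge0.
have := rip_ge0 (x - s%:C *: y); rewrite !ripE (ripC y x).
by move=> h; apply: le_trans h _; rewrite le_eqVlt; apply/orP; left; apply/eqP; ring.
Qed.

Lemma rip_le x y : `|rip x y| <= rnorm x * rnorm y.
Proof.
rewrite -ler_sqr ?nnegrE ?mulr_ge0 ?rnorm_ge0 //.
by rewrite real_normK ?num_real // exprMn -!ripxx rip_CS.
Qed.

Lemma boundedP (A : H -> H) : bounded_op A ->
  exists2 M : R, 0 <= M & forall x, rnorm (A x) <= M * rnorm x.
Proof.
move=> [M hM]; exists `|M| => // x.
apply: le_trans (_ : M * rnorm x <= _).
  by rewrite -lecR rmorphM /= -!rnormE.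
by rewrite ler_wpM2r ?rnorm_ge0 // ler_norm.
Qed.

Lemma rip_all0 x : (forall y, rip x y = 0) -> x = 0.
Proof. by move=> h; apply: rip_eq0. Qed.

Lemma rip_eq x y : (forall z, rip x z = rip y z) -> x = y.
Proof.
move=> h; apply/eqP; rewrite -subr_eq0; apply/eqP.
by apply: rip_all0 => z; rewrite !ripE h subrr.
Qed.

End RealStructure.

(** * Riesz representation and the adjoint *)

Section Complete.
Variables (R : realType) (H : completeNormedModType R[i]).

Lemma rnorm_complete (u : nat -> H) :
  (forall e : R, 0 < e -> exists N, forall m n, (N <= m)%N -> (N <= n)%N ->
     rnorm (u m - u n) <= e) ->
  exists l, forall e : R, 0 < e -> exists N, forall n, (N <= n)%N ->
     rnorm (u n - l) <= e.
Proof.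
move=> hu.
have cu : cvg (u @ \oo).
  apply/cauchy_cvgP/cauchy_exP => e e0.
  have [r r0 re] : exists2 r : R, 0 < r & e = r%:C.
    case: e e0 => a b; rewrite ltcE /= => /andP[/eqP b0 a0].
    by exists a => //; rewrite b0.
  have [N hN] := hu (r / 2) (divr_gt0 r0 (ltr0Sn _ 1)).
  exists (u N), N => // n /= Nn.
  rewrite -ball_normE /= rnormE re ltcR.
  by apply: le_lt_trans (hN _ _ _ _) _ => //; rewrite ltr_pdivrMr // ltr_pMr // ltr1n.
exists (lim (u @ \oo)) => e e0.
have /cvgrPdist_le /(_ e%:C) : u @ \oo --> lim (u @ \oo) by [].
rewrite ltcR => /(_ e0) [N _ hN]; exists N => n Nn.
by rewrite rnormC -lecR -rnormE; apply: hN.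
Qed.
End Complete.

Section Riesz.
Variables (R : realType) (H : completeNormedModType R[i]).
Variables (dot : {dot H for Num.Def.conjC}) (Hdot : hilbert_norm dot).
Local Notation rip := (redot dot).

Lemma exists_invS_le (e : R) : 0 < e -> exists N, forall n, (N <= n)%N -> n.+1%:R^-1 <= e.
Proof.
move=> e0; have [N _ hN] := near_infty_natSinv_lt (PosNum e0).
by exists N => n Nn; apply/ltW/hN.
Qed.

(* The minimizers of |x|^2 - 2 f x form a Cauchy sequence by the parallelogram
   law; its limit represents f. *)
Lemma riesz_real (f : H -> R) (M : R) :
  (forall x y, f (x + y) = f x + f y) ->
  (forall (c : R) x, f (c%:C *: x) = c * f x) ->
  (forall x, `|f x| <= M * rnorm x) ->
  exists z, forall x, f x = rip x z.
Proof.
move=> fD fZ fM.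
pose F x := rip x x - 2 * f x.
have Fge x : - M ^+ 2 <= F x.
  rewrite /F (ripxx Hdot); have := fM x; move/ler_normlP => [_].
  have := rnorm_ge0 x; have := sqr_ge0 (M - rnorm x); nra.
pose E := [set F x | x in [set: H]].
have Ei : has_inf E.
  split; first by exists (F 0), 0.
  by exists (- M ^+ 2) => _ [x _ <-].
pose m := inf E.
have mF x : m <= F x by apply: ge_inf; [case: Ei|exists x].
have xn n : exists x, F x < m + n.+1%:R^-1.
  have n0 : 0 < n.+1%:R^-1 :> R by rewrite invr_gt0.
  have [_ [x _ <-] hx] := inf_adherent n0 Ei.
  by exists x.
have [x hx] := choice xn.
have cau p q : rnorm (x p - x q) ^+ 2 <= 2 * (p.+1%:R^-1 + q.+1%:R^-1).
  have := mF ((2^-1)%:C *: (x p + x q)); have := hx p; have := hx q.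
  rewrite -(ripxx Hdot) /F !ripE fZ fD (ripC _ (x q) (x p)).
  set a := rip _ _; set b := rip _ _; set c := rip _ _.
  move: p.+1%:R^-1 q.+1%:R^-1 (f _) (f _) => e1 e2 f1 f2; lra.
have [z hz] : exists l, forall e : R, 0 < e -> exists N, forall n, (N <= n)%N ->
     rnorm (x n - l) <= e.
  apply: rnorm_complete => e e0.
  have [N hN] := exists_invS_le (divr_gt0 (exprn_gt0 2 e0) (ltr0Sn _ 3)).
  exists N => p q Np Nq; rewrite -ler_sqr ?nnegrE ?rnorm_ge0 ?(ltW e0) //.
  apply: le_trans (cau p q) _.
  by have := hN p Np; have := hN q Nq; move: p.+1%:R^-1 q.+1%:R^-1 => a b; lra.
exists z => h.
(* First variation: moving the near-minimizer [x n] along [h] lowers F by at most 1/(n+1), and the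
   discriminant of this quadratic in s bounds its linear coefficient. *)
have var n : (rip h (x n) - f h) ^+ 2 <= n.+1%:R^-1 * rip h h.
  apply: discr_le => [|s]; first exact: rip_ge0.
  have := mF (x n + (- s)%:C *: h); have := hx n.
  rewrite /F !ripE fD fZ (ripC _ (x n) h) /=.
  move: n.+1%:R^-1 => a; lra.
apply/eqP; rewrite -subr_eq0 -normr_le0; apply/ler_addgt0Pr => e e0; rewrite add0r.
pose K := rnorm h + 1.
have K0 : 0 < K by rewrite ltr_wpDl ?rnorm_ge0.
have e1 : 0 < e / 2 / K by rewrite !divr_gt0.
have [N1 h1] := hz _ e1.
have [N2 h2] := exists_invS_le (exprn_gt0 2 e1).
have {h1} := h1 (maxn N1 N2) (leq_maxl _ _).
have {h2} := h2 (maxn N1 N2) (leq_maxr _ _).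
move: (maxn N1 N2) => n n2 n1.
have -> : f h - rip h z = (rip h (x n - z)) - (rip h (x n) - f h).
  by rewrite !ripE; ring.
apply: le_trans (ler_normB _ _) _.
have hK : rnorm h <= K by rewrite lerDl.
have -> : e = K * (e / 2 / K) + K * (e / 2 / K) by field; rewrite gt_eqF.
apply: lerD.
  apply: le_trans (rip_le Hdot _ _) _.
  by apply: ler_pM; rewrite ?rnorm_ge0.
have Ke : 0 <= K * (e / 2 / K) by apply: mulr_ge0; exact: ltW.
rewrite -ler_sqr ?nnegrE // real_normK ?num_real //.
apply: le_trans (var n) _; rewrite mulrC exprMn; apply: ler_pM => //.
- exact: rip_ge0.
- by rewrite (ripxx Hdot) ler_sqr ?nnegrE ?rnorm_ge0 ?(ltW K0).
Qed.

Lemma Rei (a : R[i]) : complex.Re ('i%C * a) = - complex.Im a.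
Proof. by case: a => a b /=; rewrite mul0r mul1r sub0r. Qed.

(** The imaginary part of <x, y> is - Re <ix, y>, so the real products at x and ix determine the
    complex one. *)
Lemma rip_dot (x y z w : H) : rip x y = rip z w ->
  rip ('i%C *: x) y = rip ('i%C *: z) w -> dot x y = dot z w.
Proof.
rewrite /redot !linearZl_LR /= !Rei.
by case: (dot x y) (dot z w) => a b [c d] /= -> /oppr_inj ->.
Qed.

Lemma adjointE (A : {linear H -> H}) : bounded_op A ->
  forall x y, dot (A x) y = dot x (adjoint dot A y).
Proof.
move=> /boundedP [M M0 hM].
suff [B hB] : exists B : H -> H, forall x y, dot (A x) y = dot x (B y).
  by rewrite /adjoint; case: xgetP => [C _ //|/(_ B)].
suff : forall y, exists z, forall x, dot (A x) y = dot x z.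
  by move=> /choice [B hB]; exists B => x y; apply: hB.
move=> y.
have [z hz] : exists z, forall x, rip (A x) y = rip x z.
  apply: (riesz_real (M := M * rnorm y)) => [u v|c u|u].
  - by rewrite linearD ripDl.
  - by rewrite linearZ ripZl.
  - apply: le_trans (rip_le Hdot _ _) _.
    by rewrite mulrAC ler_wpM2r ?rnorm_ge0.
exists z => x; apply: rip_dot; first exact: hz.
by rewrite -linearZ hz.
Qed.

End Riesz.

(** * Polynomials in an operator *)

Section PolyCalculus.
Variables (R : realType) (H : completeNormedModType R[i]).

(** Complex coefficients allow a real polynomial to be split into linear factors. *)
Definition opc (q : {poly R[i]}) (T : H -> H) : H -> H :=
  fun x => \sum_(i < size q) q`_i *: iter i T x.

Section Algebra.
Variable T : {linear H -> H}.

Lemma opc_widen (q : {poly R[i]}) n x : (size q <= n)%N ->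
  opc q T x = \sum_(i < n) q`_i *: iter i T x.
Proof.
move=> qn; rewrite /opc (big_ord_widen _ (fun i => q`_i *: iter i T x) qn).
rewrite big_mkcond; apply: eq_bigr => i _; case: ltnP => // h.
by rewrite nth_default // scale0r.
Qed.

Lemma iter_is_linear n : linear (iter n T).
Proof.
by move=> c x y; elim: n => //= n ->; rewrite linearP.
Qed.

HB.instance Definition _ n :=
  GRing.isLinear.Build _ _ _ _ (iter n T) (iter_is_linear n).

Lemma opc_is_linear q : linear (opc q T).
Proof.
move=> c x y; rewrite /opc scaler_sumr -big_split /=; apply: eq_bigr => i _.
by rewrite linearP scalerDr !scalerA mulrC.
Qed.

HB.instance Definition _ q :=
  GRing.isLinear.Build _ _ _ _ (opc q T) (opc_is_linear q).

Lemma opcD p q x : opc (p + q) T x = opc p T x + opc q T x.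
Proof.
pose n := maxn (size p) (size q).
rewrite !(@opc_widen _ n) ?leq_maxl ?leq_maxr ?size_polyD // -big_split /=.
by apply: eq_bigr => i _; rewrite coefD scalerDl.
Qed.

Lemma opcZ c p x : opc (c *: p) T x = c *: opc p T x.
Proof.
rewrite !(@opc_widen _ (size p)) ?size_scale_leq // scaler_sumr.
by apply: eq_bigr => i _; rewrite coefZ scalerA.
Qed.

Lemma opcC c x : opc c%:P T x = c *: x.
Proof.
by rewrite (@opc_widen _ 1) ?size_polyC_leq1 // big_ord1 coefC eqxx.
Qed.

Lemma opc1 x : opc 1 T x = x.
Proof. by rewrite opcC scale1r. Qed.

Lemma opcMX p x : opc (p * 'X) T x = opc p T (T x).
Proof.
have pX : (size (p * 'X)%R <= (size p).+1)%N.
  by apply: leq_trans (size_polyMleq _ _) _; rewrite size_polyX addn2.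
rewrite !(@opc_widen _ (size p).+1) //.
rewrite big_ord_recl coefMX eqxx scale0r add0r big_ord_recr /=.
rewrite nth_default // scale0r addr0; apply: eq_bigr => i _.
by rewrite coefMX /= -iterSr.
Qed.

Lemma opc_XsubC c x : opc ('X - c%:P) T x = T x - c *: x.
Proof. by rewrite -['X]mul1r -polyCN opcD opcMX opc1 opcC scaleNr. Qed.

Lemma opc_comm p x : T (opc p T x) = opc p T (T x).
Proof.
rewrite /opc linear_sum; apply: eq_bigr => i _.
by rewrite linearZ /= -iterSr.
Qed.

Lemma opcM p q x : opc (p * q) T x = opc p T (opc q T x).
Proof.
elim/poly_ind: p x => [|p c IH] x.
  by rewrite mul0r -[0]/(0%:P) !opcC !scale0r.
rewrite mulrDl mulrAC !opcD !opcMX IH mul_polyC opcZ opcC.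
by rewrite opc_comm.
Qed.

Lemma op_polyE (q : {poly R}) x : op_poly q T x = opc (map_poly (real_complex R) q) T x.
Proof.
rewrite (@opc_widen _ (size q)) ?size_poly //.
by apply: eq_bigr => i _; rewrite coef_map.
Qed.

Lemma op_poly_is_linear (q : {poly R}) : linear (op_poly q T).
Proof. by move=> c x y; rewrite !op_polyE linearP. Qed.

HB.instance Definition _ q :=
  GRing.isLinear.Build _ _ _ _ (op_poly q T) (op_poly_is_linear q).

Lemma op_polyD p q x : op_poly (p + q) T x = op_poly p T x + op_poly q T x.
Proof. by rewrite !op_polyE rmorphD opcD. Qed.

Lemma op_polyZ (c : R) p x : op_poly (c *: p) T x = c%:C *: op_poly p T x.
Proof. by rewrite !op_polyE map_polyZ opcZ. Qed.

Lemma op_polyN p x : op_poly (- p) T x = - op_poly p T x.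
Proof. by rewrite -scaleN1r op_polyZ rmorphN rmorph1 scaleN1r. Qed.

Lemma op_polyB p q x : op_poly (p - q) T x = op_poly p T x - op_poly q T x.
Proof. by rewrite op_polyD op_polyN. Qed.

Lemma op_polyC c x : op_poly c%:P T x = c%:C *: x.
Proof. by rewrite op_polyE map_polyC opcC. Qed.

Lemma op_poly1 x : op_poly 1 T x = x.
Proof. by rewrite op_polyC rmorph1 scale1r. Qed.

Lemma op_polyM p q x : op_poly (p * q) T x = op_poly p T (op_poly q T x).
Proof. by rewrite !op_polyE rmorphM opcM -op_polyE. Qed.

Lemma op_polyX x : op_poly 'X T x = T x.
Proof.
by rewrite -['X]mul1r op_polyE rmorphM /= map_polyX opcMX -op_polyE op_poly1.
Qed.

Lemma op_polyXn n x : op_poly 'X^n T x = iter n T x.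
Proof.
elim: n x => [|n IH] x; first by rewrite expr0 op_poly1.
by rewrite exprS op_polyM IH op_polyX.
Qed.

Lemma op_poly_sum (I : Type) (r : seq I) (F : I -> {poly R}) x :
  op_poly (\sum_(i <- r) F i) T x = \sum_(i <- r) op_poly (F i) T x.
Proof.
elim: r => [|i r IH]; first by rewrite !big_nil op_polyC scale0r.
by rewrite !big_cons op_polyD IH.
Qed.

End Algebra.
End PolyCalculus.

(** * Positivity of the polynomial calculus *)

Section Positivity.
Variables (R : realType) (H : completeNormedModType R[i]).
Variables (dot : {dot H for Num.Def.conjC}) (Hdot : hilbert_norm dot).
Local Notation rip := (redot dot).

Definition symop (Y : H -> H) := forall x y, rip (Y x) y = rip x (Y y).

(** Symmetry alone forces real linearity. This matters for [op_pow p T], which is given only as a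
    function. *)
Lemma symopD Y : symop Y -> forall x y, Y (x + y) = Y x + Y y.
Proof.
by move=> sY x y; apply: (rip_eq Hdot) => z; rewrite sY !ripDl -!sY.
Qed.

Lemma symopZ Y : symop Y -> forall (c : R) x, Y (c%:C *: x) = c%:C *: Y x.
Proof.
by move=> sY c x; apply: (rip_eq Hdot) => z; rewrite sY !ripZl -!sY.
Qed.

Lemma symopB Y : symop Y -> forall x y, Y (x - y) = Y x - Y y.
Proof.
by move=> sY x y; apply: (rip_eq Hdot) => z; rewrite sY !ripE -!sY.
Qed.

(* Cauchy-Schwarz for the positive form <Yx,y>, at y = Yx. *)
Lemma pos_CS Y (K : R) : symop Y -> (forall x, 0 <= rip (Y x) x) ->
  0 <= K -> (forall x, rnorm (Y x) <= K * rnorm x) ->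
  forall x, rnorm (Y x) ^+ 2 <= K * rip (Y x) x.
Proof.
move=> sY pY K0 bY x.
have h : rip (Y x) (Y x) ^+ 2 <= rip (Y x) x * rip (Y (Y x)) (Y x).
  apply: discr_le => [|s]; first exact: pY.
  have := pY (x + (- s)%:C *: Y x).
  rewrite (symopD sY) (symopZ sY) !ripE (sY (Y x) x).
  by move=> h; apply: le_trans h _; rewrite le_eqVlt; apply/orP; left; apply/eqP; ring.
have h2 : rip (Y (Y x)) (Y x) <= K * rnorm (Y x) ^+ 2.
  apply: le_trans (ler_norm _) _; apply: le_trans (rip_le Hdot _ _) _.
  by rewrite expr2 mulrA ler_wpM2r ?rnorm_ge0.
move: h; rewrite (ripxx Hdot); have [->|n0] := eqVneq (rnorm (Y x)) 0.
  by rewrite expr0n /= => _; rewrite mulr_ge0.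
have {n0} n0 : 0 < rnorm (Y x) ^+ 2 by rewrite exprn_gt0 // lt_def n0 rnorm_ge0.
move=> h; rewrite -(ler_pM2r n0) -expr2; apply: le_trans h _.
by rewrite (mulrC K) -mulrA; apply: ler_wpM2l.
Qed.

Lemma ripi x y : rip ('i%C *: x) y = - rip x ('i%C *: y).
Proof.
rewrite /redot linearZl_LR linearZr_LR /= conjCE.
by case: (dot x y) => a b /=; ring.
Qed.

Lemma rnormi (x : H) : rnorm ('i%C *: x) = rnorm x.
Proof.
by rewrite /rnorm normrZ normc_def /= expr0n expr1n add0r sqrtr1 mul1r.
Qed.

Lemma ripxi x : rip x ('i%C *: x) = 0.
Proof. by have := ripi x x; rewrite ripC => /eqP; rewrite -subr_eq0 opprK -mulr2n mulrn_eq0 => /eqP. Qed.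

(** mu is the supremum of the lower bounds of the quotient f y / <y, y>. Positivity proofs by
    contradiction then only have to improve this bound by some c > 0. *)
Lemma form_inf_lt0 (f : H -> R) (C : R) x : (forall y, `|f y| <= C * rip y y) ->
  f x < 0 -> exists mu, [/\ mu < 0, forall y, mu * rip y y <= f y &
    forall c, 0 < c -> ~ (forall y, (mu + c) * rip y y <= f y)].
Proof.
move=> fC fx; have f0 : f 0 = 0.
  by apply/eqP; rewrite -normr_le0; apply: le_trans (fC 0) _; rewrite rip0r mulr0.
pose S := [set m | forall y, m * rip y y <= f y].
have pos y : f y != 0 -> 0 < rip y y.
  move=> y0; rewrite lt_def (rip_ge0 Hdot) andbT; apply: contraNneq y0.
  by move=> /(rip_eq0 Hdot) ->; rewrite f0.
have x0 : 0 < rip x x by apply: pos; rewrite lt_eqF.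
have Sub y : 0 < rip y y -> ubound S (f y / rip y y).
  by move=> y0 m Sm; rewrite ler_pdivlMr // Sm.
have Ssup : has_sup S.
  split; last by eexists; exact: Sub x0.
  by exists (- C) => y; have /ler_normlP[] := fC y; rewrite mulNr lerNl.
have le_sup y : 0 < rip y y -> sup S <= f y / rip y y.
  by move=> y0; apply: ge_sup (Sub y y0); case: Ssup.
exists (sup S); split.
- by apply: le_lt_trans (le_sup x x0) _; rewrite pmulr_llt0 // invr_gt0.
- move=> y; have [y0|y0] := eqVneq (rip y y) 0.
    by rewrite (rip_eq0 Hdot y0) rip0r mulr0 f0.
  have {}y0 : 0 < rip y y by rewrite lt_def y0 rip_ge0.
  by rewrite -ler_pdivlMr // le_sup.
- move=> c c0 /(sup_upper_bound Ssup).
  by rewrite gerDl leNgt c0.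
Qed.

Variables (T : {linear H -> H}) (M K : R).
Hypotheses (sT : symop T) (T_ge0 : forall x, 0 <= rip (T x) x)
  (T_leM : forall x, rip (T x) x <= M * rip x x)
  (K_ge0 : 0 <= K) (T_leK : forall x, rnorm (T x) <= K * rnorm x).

Lemma iter_sym n : symop (iter n T).
Proof. by elim: n => // n IH x y; rewrite iterSr /= IH sT. Qed.

Lemma op_poly_sym q : symop (op_poly q T).
Proof.
move=> x y; rewrite /op_poly.
elim/big_ind2: _ => [|a a' b b' ha hb|i _].
- by rewrite rip0l rip0r.
- by rewrite ripDl ha hb ripDr.
- by rewrite ripZl ripZr iter_sym.
Qed.

Lemma iter_bound n x : rnorm (iter n T x) <= K ^+ n * rnorm x.
Proof.
elim: n => [|n IH]; first by rewrite expr0 mul1r.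
by rewrite exprS -mulrA /=; apply: le_trans (T_leK _) _; apply: ler_wpM2l.
Qed.

Lemma op_poly_bound q : exists2 C : R, 0 <= C & forall x, rnorm (op_poly q T x) <= C * rnorm x.
Proof.
exists (\sum_(i < size q) `|q`_i| * K ^+ i).
  by apply: sumr_ge0 => i _; rewrite mulr_ge0 ?exprn_ge0.
move=> x; apply: le_trans (rnorm_sum _ _) _; rewrite mulr_suml ler_sum // => i _.
by rewrite rnormZ -mulrA ler_wpM2l // iter_bound.
Qed.

(** Pairing T x - z x with ix isolates Im z, because <T x, ix> = 0 for symmetric T. When z is real,
    pairing with x isolates its distance to [0, M]. *)
Lemma shift_bounded_below (z : R[i]) :
  (forall t, 0 <= t <= M -> z != t%:C) ->
  exists2 c : R, 0 < c & forall x, c * rnorm x <= rnorm (T x - z *: x).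
Proof.
case: z => a b hz.
have zE x : (a +i* b) *: x = a%:C *: x + b%:C *: ('i%C *: x).
  rewrite scalerA -scalerDl; congr (_ *: x).
  by apply/eqP; rewrite eq_complex /= !(mul0r, mul1r, mulr0, mulr1, subr0, addr0, add0r) !eqxx.
have below c : (forall x, c * rnorm x ^+ 2 <= `|rip (T x - (a +i* b) *: x) x|) \/
    (forall x, c * rnorm x ^+ 2 <= `|rip (T x - (a +i* b) *: x) ('i%C *: x)|) ->
    forall x, c * rnorm x <= rnorm (T x - (a +i* b) *: x).
  move=> h x; have [->|x0] := eqVneq (rnorm x) 0; first by rewrite mulr0 rnorm_ge0.
  have {x0} x0 : 0 < rnorm x by rewrite lt_def x0 rnorm_ge0.
  rewrite -(ler_pM2r x0) -mulrA -expr2.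
  case: h => h; apply: le_trans (h x) _; apply: le_trans (rip_le Hdot _ _) _ => //.
  by rewrite rnormi.
have rTi x : rip (T x) ('i%C *: x) = 0.
  suff : rip (T x) ('i%C *: x) = - rip (T x) ('i%C *: x) by lra.
  by rewrite {1}sT linearZ /= ripC ripi.
have [b0|b0] := eqVneq b 0; last first.
  exists `|b|; rewrite ?normr_gt0 //; apply: below; right => x.
  rewrite zE !ripE rTi ripxi mulr0 !(add0r, sub0r) (ripxx Hdot) rnormi.
  by rewrite normrN normrM [`|_ ^+ 2|]ger0_norm // sqr_ge0.
have rz x : rip (T x - (a +i* b) *: x) x = rip (T x) x - a * rip x x.
  by rewrite zE b0 !ripE mul0r addr0.
have [a0|a0] := ltP a 0.
  exists (- a); first by rewrite oppr_gt0.
  apply: below; left => x; rewrite rz -(ripxx Hdot).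
  by rewrite (le_trans _ (ler_norm _)) // mulNr lerDr.
have [aM|aM] := ltP M a; last first.
  by have := hz a; rewrite a0 aM b0 eqxx => /(_ isT).
exists (a - M); first by rewrite subr_gt0.
apply: below; left => x; rewrite rz -(ripxx Hdot).
rewrite -normrN opprB (le_trans _ (ler_norm _)) // mulrBl lerB //.
Qed.

Lemma rnormZc (z : R[i]) (x : H) : rnorm (z *: x) = complex.Re `|z| * rnorm x.
Proof.
by rewrite {1}/rnorm normrZ rnormE normc_def /= mulr0 subr0.
Qed.

Lemma opc_prod_bounded_below (rs : seq R[i]) :
  (forall t, 0 <= t <= M -> t%:C \notin rs) ->
  exists2 c : R, 0 < c &
    forall x, c * rnorm x <= rnorm (opc (\prod_(z <- rs) ('X - z%:P)) T x).
Proof.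
elim: rs => [|z rs IH] hrs.
  by exists 1 => // x; rewrite big_nil opc1 mul1r.
have [t ht|c c0 hc] := IH.
  by have := hrs t ht; rewrite inE negb_or => /andP[].
have [t ht|d d0 hd] := @shift_bounded_below z.
  by have := hrs t ht; rewrite inE negb_or eq_sym => /andP[].
exists (d * c); first exact: mulr_gt0.
move=> x; rewrite big_cons opcM opc_XsubC; apply: le_trans (hd _).
by rewrite -mulrA ler_wpM2l // ltW.
Qed.

(** p splits into linear factors whose roots avoid [0, M], and the lower bounds of the factors
    multiply. *)
Lemma opc_bounded_below (p : {poly R[i]}) : p != 0 ->
  (forall t, 0 <= t <= M -> p.[t%:C] != 0) ->
  exists2 c : R, 0 < c & forall x, c * rnorm x <= rnorm (opc p T x).
Proof.
move=> p0 hp; have [rs pE] := closed_field_poly_normal p.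
have [t ht|c c0 hc] := @opc_prod_bounded_below rs.
  by have := hp t ht; rewrite pE hornerZ mulf_eq0 negb_or -rootE root_prod_XsubC => /andP[].
have l0 : 0 < complex.Re `|lead_coef p|.
  have : 0 < `|lead_coef p| by rewrite normr_gt0 lead_coef_eq0.
  by rewrite normc_def ltcR.
exists (complex.Re `|lead_coef p| * c); first exact: mulr_gt0.
by move=> x; rewrite {2}pE opcZ rnormZc -mulrA ler_wpM2l // ltW.
Qed.

(* If the bottom mu of q(T) were negative, q - mu would have all its roots off
   [0, M]; then q(T) - mu would be bounded below, so mu would not be the bottom. *)
Lemma op_poly_ge0 (q : {poly R}) : (forall t, 0 <= t <= M -> 0 <= q.[t]) ->
  forall x, 0 <= rip (op_poly q T x) x.
Proof.
move=> hq x; rewrite leNgt; apply/negP => qx.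
have [C C0 hC] := op_poly_bound q.
have [|mu [mu0 muS mu_max]] := @form_inf_lt0 (fun y => rip (op_poly q T y) y) C x _ qx.
  move=> y; apply: le_trans (rip_le Hdot _ _) _.
  by rewrite (ripxx Hdot) expr2 mulrA ler_wpM2r ?rnorm_ge0.
have x0 : 0 < rip x x.
  rewrite lt_def (rip_ge0 Hdot) andbT; apply: contraTneq qx => /(rip_eq0 Hdot) ->.
  by rewrite rip0r ltxx.
pose Y := op_poly (q - mu%:P) T.
have YE y : rip (Y y) y = rip (op_poly q T y) y - mu * rip y y.
  by rewrite /Y op_polyB op_polyC !ripE.
have Y_ge0 y : 0 <= rip (Y y) y by rewrite YE subr_ge0 muS.
have M0 : 0 <= M.
  by rewrite -(pmulr_lge0 _ x0); apply: le_trans (T_ge0 x) (T_leM x).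
have hr t : 0 <= t <= M -> (map_poly (real_complex R) (q - mu%:P)).[t%:C] != 0.
  move=> /hq qt; rewrite horner_map fmorph_eq0 hornerD hornerN hornerC.
  by rewrite gt_eqF // subr_gt0 (lt_le_trans mu0).
have [|c c0 hc] := @opc_bounded_below (map_poly (real_complex R) (q - mu%:P)) _ hr.
  by apply/eqP => h0; have := hr 0; rewrite h0 horner0 eqxx lexx M0 => /(_ isT).
have [D D0 hD] := op_poly_bound (q - mu%:P).
pose E := D + 1; have E0 : 0 < E by rewrite ltr_wpDl.
have hE y : rnorm (Y y) <= E * rnorm y.
  by apply: le_trans (hD y) _; rewrite ler_wpM2r ?rnorm_ge0 // lerDl.
(* c |y| <= |Y y| and |Y y|^2 <= E <Y y, y> together put c^2 / E below the form of Y. *)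
apply: (mu_max (c ^+ 2 / E)) => [|y]; first by rewrite divr_gt0 // exprn_gt0.
rewrite mulrDl -lerBrDl -YE mulrAC ler_pdivrMr // (mulrC _ E).
apply: le_trans (pos_CS _ Y_ge0 (ltW E0) hE y); last exact: op_poly_sym.
rewrite (ripxx Hdot) -exprMn ler_sqr ?nnegrE ?mulr_ge0 ?rnorm_ge0 ?(ltW c0) //.
by rewrite /Y op_polyE.
Qed.

Lemma op_poly_le (p q : {poly R}) : (forall t, 0 <= t <= M -> p.[t] <= q.[t]) ->
  forall x, rip (op_poly p T x) x <= rip (op_poly q T x) x.
Proof.
move=> pq x; rewrite -subr_ge0 -ripNl -ripDl -op_polyB.
by apply: op_poly_ge0 => t /pq; rewrite hornerD hornerN subr_ge0.
Qed.

(** By symmetry |p(T) x|^2 is the form of p^2 at x, so the squares can be compared pointwise. *)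
Lemma op_poly_norm_le (p q : {poly R}) :
  (forall t, 0 <= t <= M -> `|p.[t]| <= `|q.[t]|) ->
  forall x, rnorm (op_poly p T x) <= rnorm (op_poly q T x).
Proof.
move=> pq x; rewrite -ler_sqr ?nnegrE ?rnorm_ge0 // -!(ripxx Hdot) -!op_poly_sym.
rewrite -!op_polyM; apply: op_poly_le => t /pq.
by rewrite -ler_sqr ?nnegrE // !real_normK ?num_real // !hornerM !expr2.
Qed.

Lemma op_poly_norm (p : {poly R}) e : (forall t, 0 <= t <= M -> `|p.[t]| <= e) ->
  forall x, rnorm (op_poly p T x) <= `|e| * rnorm x.
Proof.
move=> pe x; rewrite -rnormZ -(op_polyC T); apply: op_poly_norm_le => t /pe h.
by rewrite hornerC (le_trans h) // ler_norm.
Qed.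

End Positivity.

(** * Bernstein polynomials *)

Section Bernstein.

(* [bern u k f] is the Bernstein sum
   \sum_(j < k.+1) 'C(k, j) u ^+ j (1 - u) ^+ (k - j) f j. *)
Fixpoint bern (A : comNzRingType) (u : A) (k : nat) (f : nat -> A) : A :=
  if k is k'.+1 then (1 - u) * bern u k' f + u * bern u k' (fun j => f j.+1)
  else f 0.

Section Ring.
Variables (A : comNzRingType) (u : A).

Lemma bernS k f :
  bern u k.+1 f = (1 - u) * bern u k f + u * bern u k (fun j => f j.+1).
Proof. by []. Qed.

Lemma eq_bern k (f g : nat -> A) :
  (forall j, (j <= k)%N -> f j = g j) -> bern u k f = bern u k g.
Proof.
elim: k f g => [|k IH] f g fg; first exact: fg.
by rewrite /= (IH f g) ?(IH (fun j => f j.+1) (fun j => g j.+1)) // => j jk;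
  apply: fg; rewrite // ltnW.
Qed.

Lemma bernD k (f g : nat -> A) :
  bern u k (fun j => f j + g j) = bern u k f + bern u k g.
Proof.
elim: k f g => [|k IH] f g //=.
by rewrite (IH f g) (IH (fun j => f j.+1)); ring.
Qed.

Lemma bernZ k (c : A) f : bern u k (fun j => c * f j) = c * bern u k f.
Proof.
elim: k f => [|k IH] f //=.
by rewrite (IH f) (IH (fun j => f j.+1)); ring.
Qed.

Lemma bern_cst k (c : A) : bern u k (fun=> c) = c.
Proof. by elim: k => [|k IH] //=; rewrite IH; ring. Qed.

Lemma bern_sum k (I : Type) (r : seq I) (F : I -> nat -> A) :
  bern u k (fun j => \sum_(i <- r) F i j) = \sum_(i <- r) bern u k (F i).
Proof.
elim: r => [|i r IH].
  by rewrite big_nil (@eq_bern _ _ (fun=> 0)) ?bern_cst // => j _; rewrite big_nil.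
rewrite big_cons -IH -bernD; apply: eq_bern => j _; exact: big_cons.
Qed.

(** [bern u k f] is the mean of f under the binomial law of k trials with parameter u. Conditioning
    on one trial shifts the centred count by - u or 1 - u; the variance is computed in the same
    way. *)
Lemma bern_mean k : bern u k (fun j => j%:R - k%:R * u) = 0.
Proof.
elim: k => [|k IH]; first by rewrite /= mul0r subr0.
rewrite bernS.
rewrite (@eq_bern k _ (fun j => (j%:R - k%:R * u) + - u)); last by move=> j _; rewrite -!natr1; ring.
rewrite (@eq_bern k (fun j => j.+1%:R - k.+1%:R * u) (fun j => (j%:R - k%:R * u) + (1 - u))); last by move=> j _; rewrite -!natr1; ring.
by rewrite bernD bern_cst IH bernD bern_cst IH; ring.
Qed.

Lemma bern_variance k :
  bern u k (fun j => (j%:R - k%:R * u) ^+ 2) = k%:R * (u * (1 - u)).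
Proof.
elim: k => [|k IH]; first by rewrite /= !mul0r subr0 expr0n.
rewrite bernS.
have E c : bern u k (fun j => (j%:R - k%:R * u + c) ^+ 2) = k%:R * (u * (1 - u)) + c ^+ 2.
  rewrite (@eq_bern k _ (fun j => (j%:R - k%:R * u) ^+ 2 + (2 * c * (j%:R - k%:R * u) + c ^+ 2))).
    by rewrite bernD IH bernD bernZ bern_mean bern_cst mulr0 add0r.
  by move=> j _; ring.
rewrite (@eq_bern k _ (fun j => (j%:R - k%:R * u + - u) ^+ 2)); last by move=> j _; rewrite -!natr1; ring.
rewrite (@eq_bern k (fun j => (j.+1%:R - k.+1%:R * u) ^+ 2) (fun j => (j%:R - k%:R * u + (1 - u)) ^+ 2)); last by move=> j _; rewrite -!natr1; ring.
by rewrite !E -natr1; ring.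
Qed.

End Ring.

Lemma horner_bern (A : comNzRingType) (u : {poly A}) k f t :
  (bern u k f).[t] = bern u.[t] k (fun j => (f j).[t]).
Proof. by elim: k f => [|k IH] f //=; rewrite !hornerE !IH. Qed.

Lemma ler_bern (R : realFieldType) (u : R) k (f g : nat -> R) : 0 <= u <= 1 ->
  (forall j, (j <= k)%N -> f j <= g j) -> bern u k f <= bern u k g.
Proof.
move=> /andP[u0 u1]; elim: k f g => [|k IH] f g fg; first exact: fg.
rewrite /= lerD // ler_wpM2l ?subr_ge0 // IH // => j jk; apply: fg => //.
exact: ltnW.
Qed.

Lemma bern_sqdist (R : realFieldType) (M t : R) k : 0 < M -> 0 <= t <= M ->
  (0 < k)%N -> bern (M^-1 * t) k (fun j => (M * (j%:R / k%:R) - t) ^+ 2) <= M ^+ 2 / k%:R.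
Proof.
move=> M0 /andP[t0 tM] k_gt0; set u := M^-1 * t.
have k0 : 0 < k%:R :> R by rewrite ltr0n.
have tE : t = M * u by rewrite mulVKf ?gt_eqF.
rewrite (@eq_bern _ _ _ _ (fun j => (M / k%:R) ^+ 2 * (j%:R - k%:R * u) ^+ 2)); last first.
  by move=> j _; rewrite -exprMn tE; congr (_ ^+ 2); field; rewrite gt_eqF.
rewrite bernZ bern_variance.
have -> : (M / k%:R) ^+ 2 * (k%:R * (u * (1 - u))) = M ^+ 2 / k%:R * (u * (1 - u)).
  by field; rewrite gt_eqF.
rewrite ger_pMr ?divr_gt0 ?exprn_gt0 //.
have [u0 u1] : 0 <= u /\ u <= 1.
  by rewrite /u mulr_ge0 ?invr_ge0 ?(ltW M0) // mulrC ler_pdivrMr ?mul1r.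
by nra.
Qed.

(** Uniform continuity in the form that Bernstein sums absorb: the mean of the quadratic term is a
    variance. *)
Definition quad_modulus (R : realType) (M : R) (f : R -> R) :=
  forall e, 0 < e -> exists C, forall a b, 0 <= a <= M -> 0 <= b <= M ->
    `|f a - f b| <= e + C * (a - b) ^+ 2.

Lemma weierstrass (R : realType) (M : R) f : 0 < M -> quad_modulus M f ->
  forall e, 0 < e -> exists q : {poly R}, forall t, 0 <= t <= M -> `|q.[t] - f t| <= e.
Proof.
move=> M0 hf e e0; have [C0 hC0] := hf (e / 2) (divr_gt0 e0 (ltr0Sn _ 1)).
pose C := `|C0| + 1; have C_gt0 : 0 < C by rewrite ltr_wpDl.
have hC a b : 0 <= a <= M -> 0 <= b <= M -> `|f a - f b| <= e / 2 + C * (a - b) ^+ 2.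
  move=> ha hb; apply: le_trans (hC0 _ _ ha hb) _; rewrite lerD2l ler_wpM2r ?sqr_ge0 //.
  by rewrite (le_trans (ler_norm _)) // lerDl.
(* The degree k makes the variance term C M^2 / k at most e / 2. *)
have [k' hk'] : exists N, forall n, (N <= n)%N -> n.+1%:R^-1 <= e / 2 / (C * M ^+ 2).
  by apply: exists_invS_le; rewrite !divr_gt0 // mulr_gt0 // exprn_gt0.
have {hk'} := hk' k' (leqnn _); set k := k'.+1 => hk.
have k0 : 0 < k%:R :> R by rewrite ltr0n.
pose x j : R := M * (j%:R / k%:R).
exists (bern (M^-1 *: 'X) k (fun j => (f (x j))%:P)) => t tM.
rewrite horner_bern (@eq_bern _ _ _ _ (fun j => f (x j))); last by move=> j _; rewrite hornerC.
rewrite hornerZ hornerX; set u := M^-1 * t.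
have u01 : 0 <= u <= 1.
  have /andP[t0 tM'] := tM; rewrite /u mulr_ge0 ?invr_ge0 ?(ltW M0) //=.
  by rewrite mulrC ler_pdivrMr ?mul1r.
have xM j : (j <= k)%N -> 0 <= x j <= M.
  move=> jk; rewrite /x mulr_ge0 ?divr_ge0 ?(ltW M0) //=.
  by rewrite ger_pMr // ler_pdivrMr // mul1r ler_nat.
have bnd : bern u k (fun j => e / 2 + C * (x j - t) ^+ 2) <= e.
  rewrite bernD bern_cst bernZ.
  have h1 := ler_wpM2l (ltW C_gt0) (bern_sqdist M0 tM (ltn0Sn k')).
  have h2 : C * (M ^+ 2 / k%:R) <= e / 2.
    by rewrite mulrA mulrC -ler_pdivlMr // mulr_gt0 // exprn_gt0.
  by rewrite [leRHS]splitr lerD2l (le_trans h1).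
have both j : (j <= k)%N -> `|f (x j) - f t| <= e / 2 + C * (x j - t) ^+ 2.
  by move=> jk; apply: hC => //; exact: xM.
rewrite ler_norml; apply/andP; split.
  rewrite lerNl opprB; apply: le_trans bnd; rewrite lerBlDr.
  rewrite -[f t](bern_cst u k) -bernD; apply: ler_bern => // j /both.
  by rewrite ler_norml => /andP[h _]; lra.
rewrite lerBlDr; apply: le_trans (lerD bnd (lexx (f t))).
rewrite -[X in _ + X](bern_cst u k (f t)) -bernD; apply: ler_bern => // j /both.
by rewrite ler_norml => /andP[_ h]; lra.
Qed.

Lemma quad_modulusX (R : realType) (M B : R) f n : 0 <= B ->
  (forall t, 0 <= t <= M -> `|f t| <= B) ->
  quad_modulus M f -> quad_modulus M (fun t => f t ^+ n).
Proof.
move=> B0 fB hf; elim: n => [|n IH] e e0.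
  by exists 0 => a b _ _; rewrite !expr0 subrr normr0 mul0r addr0 ltW.
pose D := B ^+ n + B + 1.
have D0 : 0 < D by rewrite ltr_wpDl // addr_ge0 // exprn_ge0.
have d0 : 0 < e / (2 * D) by rewrite divr_gt0 // mulr_gt0.
have [C1 h1] := hf _ d0; have [C2 h2] := IH _ d0.
exists (B ^+ n * C1 + B * C2) => a b ha hb.
have -> : f a ^+ n.+1 - f b ^+ n.+1 = f a ^+ n * (f a - f b) + f b * (f a ^+ n - f b ^+ n).
  by rewrite !exprS; ring.
apply: le_trans (ler_normD _ _) _; rewrite !normrM.
have k1 : `|f a ^+ n| <= B ^+ n by rewrite normrX lerXn2r ?nnegrE // fB.
have k2 : `|f a ^+ n| * `|f a - f b| <= B ^+ n * (e / (2 * D) + C1 * (a - b) ^+ 2).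
  by apply: ler_pM => //; apply: h1.
have k3 : `|f b| * `|f a ^+ n - f b ^+ n| <= B * (e / (2 * D) + C2 * (a - b) ^+ 2).
  by apply: ler_pM => //; [apply: fB|apply: h2].
apply: le_trans (lerD k2 k3) _.
have k4 : (B ^+ n + B) * (e / (2 * D)) <= e.
  apply: le_trans (_ : D * (e / (2 * D)) <= _).
    by rewrite ler_wpM2r ?(ltW d0) // lerDl.
  have -> : D * (e / (2 * D)) = e / 2 by field; rewrite gt_eqF.
  by rewrite ler_pdivrMr // ler_pMr // ler1n.
move: k4; move: (B ^+ n) (e / _) ((a - b) ^+ 2) => b1 b2 b3; lra.
Qed.

(** A fraction in [0, 1] is at most its p-th power when p <= 1; this is applied to a / (a + b) and b
    / (a + b). *)
Lemma powR_subadd (R : realType) (p a b : R) : 0 < p <= 1 -> 0 <= a -> 0 <= b ->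
  (a + b) `^ p <= a `^ p + b `^ p.
Proof.
move=> /andP[p0 p1] a0 b0; have [s0|s0] := eqVneq (a + b) 0.
  by rewrite s0 powR0 ?gt_eqF // addr_ge0 ?powR_ge0.
have {}s0 : 0 < a + b by rewrite lt_def s0 addr_ge0.
have h c : 0 <= c -> c <= a + b -> c / (a + b) * (a + b) `^ p <= c `^ p.
  move=> c0 cs; have [->|cn0] := eqVneq c 0.
    by rewrite !mul0r powR_ge0.
  have {}cn0 : 0 < c by rewrite lt_def cn0.
  have {2}-> : c = c / (a + b) * (a + b) by rewrite divfK ?gt_eqF.
  rewrite powRM ?divr_ge0 ?addr_ge0 // ler_wpM2r ?powR_ge0 //.
  by apply: ger1_powR => //; rewrite divr_gt0 // ler_pdivrMr // mul1r.
have := lerD (h a a0 _) (h b b0 _); rewrite -!mulrDl divff ?gt_eqF // mul1r.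
by apply; rewrite ?lerDl ?lerDr.
Qed.

Lemma powR_le (R : realType) (r a b : R) : 0 <= r -> 0 <= a -> a <= b -> a `^ r <= b `^ r.
Proof. by move=> r0 a0 ab; apply: ge0_ler_powR => //; rewrite nnegrE //; exact: le_trans ab. Qed.

(** For an exponent r <= 1, subadditivity gives |a^r - b^r| <= |a - b|^r. This is at most e up to
    the distance d = e^(1/r), and beyond d the quadratic term exceeds M^r. Any other p is reached as
    the n-th power of t^(p/n) with n >= p. *)
Lemma quad_modulus_powR (R : realType) (p M : R) : 0 < p ->
  quad_modulus M (fun t => t `^ p).
Proof.
move=> p0.
have small r : 0 < r <= 1 -> quad_modulus M (fun t => t `^ r).
  move=> /andP[r0 r1] e e0; pose d := e `^ r^-1.
  have d0 : 0 < d by rewrite powR_gt0.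
  have dr : d `^ r = e by rewrite -powRrM mulVf ?gt_eqF // powRr1 // ltW.
  pose C := M `^ r / d ^+ 2; exists C.
  have C0 : 0 <= C by rewrite divr_ge0 ?powR_ge0 // exprn_ge0 // ltW.
  have key a b : 0 <= a -> a <= b -> b <= M -> `|a `^ r - b `^ r| <= e + C * (a - b) ^+ 2.
    move=> a0 ab bM; rewrite distrC ger0_norm; last first.
      by rewrite subr_ge0 powR_le // ltW.
    have ba : 0 <= b - a by rewrite subr_ge0.
    apply: le_trans (_ : (b - a) `^ r <= _).
      rewrite lerBlDr; apply: le_trans (powR_subadd _ _ _); rewrite ?r0 ?r1 //.
      by rewrite subrK.
    have [bd|bd] := lerP (b - a) d.
      apply: le_trans (_ : e <= _); last by rewrite lerDl mulr_ge0 ?sqr_ge0.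
      by rewrite -[leRHS]dr powR_le // ltW.
    apply: le_trans (_ : M `^ r <= _).
      by rewrite powR_le ?(ltW r0) //; lra.
    rewrite -[leLHS]add0r lerD ?(ltW e0) // /C mulrAC -mulrA ler_peMr ?powR_ge0 //.
    rewrite ler_pdivlMr ?exprn_gt0 // mul1r -(sqrrN (a - b)) opprB.
    by rewrite ler_sqr ?nnegrE ?(ltW d0) // ltW.
  move=> a b /andP[a0 aM] /andP[b0 bM]; have [ab|/ltW ba] := lerP a b.
    exact: key.
  by rewrite distrC -(sqrrN (a - b)) opprB; apply: key.
pose n := (Num.truncn p).+1.
have n0 : 0 < n%:R :> R by rewrite ltr0n.
have pn : p <= n%:R by rewrite ltW // truncnS_gt.
have hp : 0 < p / n%:R <= 1 by rewrite divr_gt0 //= ler_pdivrMr // mul1r.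
have := @quad_modulusX R M (`|M| `^ (p / n%:R)) _ n (powR_ge0 _ _) _ (small _ hp).
move=> h e e0; have [|C hC] := h _ e e0.
  move=> t /andP[t0 tM]; rewrite ger0_norm ?powR_ge0 // powR_le //.
    by rewrite divr_ge0 ?(ltW p0).
  by rewrite (le_trans tM) // ler_norm.
exists C => a b ha hb; have := hC a b ha hb.
have E t : (t `^ (p / n%:R)) ^+ n = t `^ p.
  by rewrite -powR_mulrn ?powR_ge0 // -powRrM divfK ?gt_eqF.
by rewrite !E.
Qed.

Lemma powR_approx (R : realType) (p M e : R) : 0 < p -> 0 < M -> 0 < e ->
  exists q : {poly R}, forall t, 0 <= t <= M -> `|q.[t] - t `^ p| <= e.
Proof. by move=> p0 M0; apply: weierstrass => //; exact: quad_modulus_powR. Qed.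

End Bernstein.

(** * Real powers of positive operators *)

Lemma uniform_seqP (R : realType) (A : set R) (u : nat -> R -> R) (f : R -> R) :
  {uniform A, u @ \oo --> f} <->
  (forall e, 0 < e -> exists N, forall n, (N <= n)%N ->
    forall t, A t -> `|u n t - f t| <= e).
Proof.
split=> [cu e e0|hu].
  have /cu [N _ hN] : nbhs (f : {uniform` A -> R}) [set h | forall y, A y -> `|h y - f y| <= e].
    apply/uniform_nbhs; exists [set xy | ball xy.1 e xy.2]; split.
      exact: entourage_ball (PosNum e0).
    by move=> h hh y Ay /=; have := hh y Ay; rewrite /= -ball_normE /= distrC => /ltW.
  by exists N => n /hN.
move=> P /uniform_nbhs [E [entE EP]].
have [e /= e0 eE] : exists2 e : R, 0 < e & [set xy | ball xy.1 e xy.2] `<=` E.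
  by move: entE; rewrite -entourage_ballE => -[e e0 h]; exists e.
have [N hN] := hu (e / 2) (divr_gt0 e0 (ltr0Sn _ 1)).
exists N => // n Nn; apply: EP => t At; apply: eE => /=.
rewrite -ball_normE /= distrC (le_lt_trans (hN n Nn t At)) //.
by rewrite ltr_pdivrMr // ltr_pMr // ltr1n.
Qed.

Section Opnorm.
Variables (R : realType) (H : completeNormedModType R[i]).

Lemma opnormP (A : H -> H) : bounded_op A ->
  0 <= opnorm A /\ forall x, rnorm (A x) <= opnorm A * rnorm x.
Proof.
move=> /boundedP [M M0 hM].
pose S := [set M : R | 0 <= M /\ forall x, `|A x| <= M%:C * `|x|].
have S0 : S !=set0.
  exists M; split => // x; rewrite !rnormE -rmorphM lecR; exact: hM.
split; first by apply: lb_le_inf => // m [].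
move=> x; have [x0|x0] := eqVneq (rnorm x) 0.
  by have := hM x; rewrite x0 !mulr0.
have {}x0 : 0 < rnorm x by rewrite lt_def x0 rnorm_ge0.
rewrite -ler_pdivrMr //; apply: lb_le_inf => // m [_ /(_ x)].
by rewrite !rnormE -rmorphM lecR ler_pdivrMr.
Qed.

Lemma op_cvgP (S : nat -> H -> H) (T : H -> H) : op_cvg S T <->
  (forall e, 0 < e -> exists N, forall n, (N <= n)%N ->
    forall x, rnorm (S n x - T x) <= e * rnorm x).
Proof.
split=> hS e e0.
  have [N _ hN] := hS e e0; exists N => n /hN h x.
  by have := h x; rewrite !rnormE -rmorphM lecR.
have [N hN] := hS e e0; exists N => // n /= /hN h x.
by rewrite !rnormE -rmorphM lecR.
Qed.

End Opnorm.

Section OpPow.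
Variables (R : realType) (H : completeNormedModType R[i]).
Variables (dot : {dot H for Num.Def.conjC}) (Hdot : hilbert_norm dot).
Local Notation rip := (redot dot).

Variable (T : {linear H -> H}).
Hypotheses (sT : symop dot T) (T_ge0 : forall x, 0 <= rip (T x) x)
  (bT : bounded_op T).
Local Notation N := (opnorm T).

Lemma rip_opnorm x : rip (T x) x <= N * rip x x.
Proof.
have [N0 hN] := opnormP bT.
apply: le_trans (ler_norm _) _; apply: le_trans (rip_le Hdot _ _) _.
by rewrite (ripxx Hdot) expr2 mulrA ler_wpM2r ?rnorm_ge0.
Qed.

Lemma op_polyB_norm (q r : {poly R}) e : 0 <= e ->
  (forall t, 0 <= t <= N -> `|q.[t] - r.[t]| <= e) ->
  forall x, rnorm (op_poly q T x - op_poly r T x) <= e * rnorm x.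
Proof.
move=> e0 h x; have [N0 hN] := opnormP bT.
rewrite -op_polyB -[e in leRHS]ger0_norm //.
apply: (op_poly_norm Hdot sT T_ge0 rip_opnorm N0 hN) => t /h.
by rewrite hornerD hornerN.
Qed.

Variables (p : R) (p0 : 0 < p).

Lemma fun_calc_powR_exists : exists S, is_fun_calc (fun t => t `^ p) T S.
Proof.
have [N0 hN] := opnormP bT.
(* [opnorm T] may be 0, whereas the approximation needs an interval of positive length. *)
have N1 : 0 < N + 1 by rewrite ltr_wpDl.
have n0 n : 0 < n.+1%:R^-1 :> R by rewrite invr_gt0.
have [q hq] := choice (fun n => powR_approx p0 N1 (n0 n)).
have hqN n t : 0 <= t <= N -> `|(q n).[t] - t `^ p| <= n.+1%:R^-1.
  by move=> /andP[t0 tN]; apply: hq; rewrite t0 (le_trans tN) // lerDl.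
have diff m n x : rnorm (op_poly (q m) T x - op_poly (q n) T x) <=
    (m.+1%:R^-1 + n.+1%:R^-1) * rnorm x.
  apply: op_polyB_norm => [|t ht]; first by rewrite addr_ge0 // ltW.
  rewrite -[X in `|X|](subrKA (t `^ p)) (le_trans (ler_normD _ _)) // lerD ?hqN //.
  by rewrite distrC hqN.
have lim x : exists l, forall e : R, 0 < e -> exists K, forall n, (K <= n)%N ->
     rnorm (op_poly (q n) T x - l) <= e.
  apply: rnorm_complete => e e0.
  have x1 : 0 < rnorm x + 1 by rewrite ltr_wpDl ?rnorm_ge0.
  have [K hK] := exists_invS_le (divr_gt0 (divr_gt0 e0 (ltr0Sn _ 1)) x1).
  exists K => m n Km Kn; apply: le_trans (diff m n x) _.
  apply: le_trans (_ : (e / 2 / (rnorm x + 1) + e / 2 / (rnorm x + 1)) * (rnorm x + 1) <= _).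
    by apply: ler_pM; rewrite ?addr_ge0 ?rnorm_ge0 ?lerD ?hK ?lerDl // ltW.
  by rewrite -mulrDl -splitr divfK // gt_eqF.
have [S hS] := choice lim.
exists S, q; split.
  apply/uniform_seqP => e e0; have [K hK] := exists_invS_le e0.
  exists K => n Kn t; rewrite /= in_itv /= => /(hqN n) h.
  exact: le_trans h (hK _ Kn).
apply/op_cvgP => e e0; have [K hK] := exists_invS_le (divr_gt0 e0 (ltr0Sn _ 1)).
exists K => n Kn x; apply/ler_addgt0Pr => d d0.
(* The index m depends on x, but its contribution d is arbitrary; the remaining bound is uniform in
   x. *)
have [K' hK'] := hS x d d0; pose m := maxn K K'.
rewrite -[X in rnorm X](subrKA (op_poly (q m) T x)).
apply: le_trans (rnormD _ _) _; apply: lerD; last by rewrite hK' // leq_maxr.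
apply: le_trans (diff n m x) _; rewrite ler_wpM2r ?rnorm_ge0 //.
by rewrite [leRHS]splitr lerD // hK // leq_maxl.
Qed.

(** The polynomials behind [op_pow] come within any c of t^p, hence within e + c of q, and c is
    arbitrary. All later facts on [op_pow] go through this estimate, so the chosen approximating
    sequence does not matter. *)
Lemma op_pow_close q e : (forall t, 0 <= t <= N -> `|q.[t] - t `^ p| <= e) ->
  forall x, rnorm (op_poly q T x - op_pow p T x) <= e * rnorm x.
Proof.
move=> hq x.
have : is_fun_calc (fun t => t `^ p) T (op_pow p T).
  have [S hS] := fun_calc_powR_exists.
  by rewrite /op_pow; case: xgetP => [? -> //|/(_ S)].
move=> [r [/uniform_seqP hr /op_cvgP hS]].
have [N0 _] := opnormP bT.
have e0 : 0 <= e by apply: le_trans (hq 0 _); rewrite ?lexx.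
apply/ler_addgt0Pr => d d0.
have x1 : 0 < rnorm x + 1 by rewrite ltr_wpDl ?rnorm_ge0.
pose c := d / 2 / (rnorm x + 1).
have c0 : 0 < c by rewrite !divr_gt0.
have [K1 h1] := hr c c0; have [K2 h2] := hS c c0; pose n := maxn K1 K2.
rewrite -[X in rnorm X](subrKA (op_poly (r n) T x)).
apply: le_trans (rnormD _ _) _.
apply: le_trans (_ : (e + c) * rnorm x + c * rnorm x <= _).
  apply: lerD; last by rewrite h2 // leq_maxr.
  apply: op_polyB_norm => [|t ht]; first by rewrite addr_ge0 // ltW.
  rewrite -[X in `|X|](subrKA (t `^ p)) (le_trans (ler_normD _ _)) // lerD ?hq //.
  by rewrite distrC h1 ?leq_maxl //= in_itv.
rewrite mulrDl -addrA lerD2l -mulrDl -mulr2n.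
apply: le_trans (_ : c *+ 2 * (rnorm x + 1) <= _).
  by rewrite ler_wpM2l ?mulrn_wge0 ?(ltW c0) // lerDl.
by rewrite (_ : c *+ 2 * (rnorm x + 1) = d) // /c; field; rewrite gt_eqF.
Qed.

(** The free bound M lets a single q serve two operators at once. *)
Lemma op_pow_approx (M e : R) : 0 < e -> exists q : {poly R},
  (forall t, 0 <= t <= M -> `|q.[t] - t `^ p| <= e) /\
  forall x, rnorm (op_poly q T x - op_pow p T x) <= e * rnorm x.
Proof.
move=> e0; have [N0 _] := opnormP bT.
have M1 : 0 < Num.max M N + 1 by rewrite ltr_wpDl // le_max N0 orbT.
have [q hq] := powR_approx p0 M1 e0; exists q; split.
  move=> t /andP[t0 tM]; apply: hq; rewrite t0 (le_trans tM) //.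
  by rewrite (le_trans (_ : _ <= Num.max M N)) ?le_max ?lexx ?lerDl.
apply: op_pow_close => t /andP[t0 tM]; apply: hq; rewrite t0 (le_trans tM) //.
by rewrite (le_trans (_ : _ <= Num.max M N)) ?le_max ?lexx ?orbT ?lerDl.
Qed.

End OpPow.

(** * Tangent lines of real powers *)

Section Tangents.
Variable R : realType.

(** For p < 1 this is Young's inequality for t^p and l^(1-p) with exponents 1/p and 1/(1-p), divided
    by l^(1-p). *)
Lemma tangent_powR (p l t : R) : 0 < p <= 1 -> 0 < l -> 0 <= t ->
  t `^ p <= (1 - p) * l `^ p + p * l `^ (p - 1) * t.
Proof.
move=> /andP[p0 p1] l0 t0.
have lE : l `^ p = l * l `^ (p - 1) by rewrite mulr_powRB1 // ltW.
have [->|pn1] := eqVneq p 1.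
  by rewrite subrr mul0r add0r powRr1 // powRr0 !mul1r.
have {pn1}p1 : p < 1 by rewrite lt_def eq_sym pn1.
have q0 : 0 < 1 - p by rewrite subr_gt0.
have := @conjugate_powR R (t `^ p) (l `^ (1 - p)) p^-1 (1 - p)^-1 (powR_ge0 _ _) (powR_ge0 _ _).
have e1 : p^-1^-1 + (1 - p)^-1^-1 = 1 by rewrite !invrK; ring.
rewrite !invr_gt0 => /(_ p0 q0 e1); rewrite !invrK -!powRrM !divff ?gt_eqF // !powRr1 ?(ltW l0) // => h.
have m0 : 0 < l `^ (p - 1) by rewrite powR_gt0.
have inv : l `^ (1 - p) * l `^ (p - 1) = 1.
  by rewrite -powRD ?(gt_eqF l0) ?implybT // addrA subrK subrr powRr0.
have {h} h1 : t `^ p * (l `^ (1 - p) * l `^ (p - 1)) <=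
    (t * p + l * (1 - p)) * l `^ (p - 1) by rewrite mulrA ler_wpM2r ?(ltW m0).
move: h1; rewrite inv mulr1 => h.
by apply: le_trans h _; rewrite lE le_eqVlt; apply/orP; left; apply/eqP; ring.
Qed.

(** Young's inequality for t and l^p with exponents p + 1 and (p + 1)/p. The power t^(p+1) is kept
    as a product to match [op_pow_ge_poly]. *)
Lemma tangent_mul_powR (p l t : R) : 0 < p -> 0 < l -> 0 <= t ->
  (p + 1) * l `^ p * t - p * (l `^ p * l) <= t * t `^ p.
Proof.
move=> p0 l0 t0.
have p1 : 0 < p + 1 by rewrite ltr_wpDl // ltW.
have := @conjugate_powR R t (l `^ p) (p + 1) ((p + 1) / p) t0 (powR_ge0 _ _) p1 (divr_gt0 p1 p0).
have -> : (p + 1)^-1 + ((p + 1) / p)^-1 = 1 by field; rewrite !gt_eqF.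
move=> /(_ erefl); rewrite -powRrM.
have -> : p * ((p + 1) / p) = p + 1 by field; rewrite gt_eqF.
have E a : 0 <= a -> a `^ (p + 1) = a * a `^ p.
  by move=> a0; rewrite -(mulr_powRB1 a0 p1) addrK.
rewrite !E ?(ltW l0) // => h; have {h} := ler_wpM2l (ltW p1) h.
have -> : (p + 1) * (t * t `^ p / (p + 1) + l * l `^ p / ((p + 1) / p)) =
  t * t `^ p + p * (l `^ p * l) by field; rewrite !gt_eqF.
by move=> h; rewrite lerBlDr; apply: le_trans h; rewrite (mulrC t) mulrA.
Qed.

Lemma le0_of_eps (a K : R) : (forall e, 0 < e -> a <= e * K) -> a <= 0.
Proof.
move=> h; apply/ler_addgt0Pr => d d0; rewrite add0r.
have K0 : 0 < `|K| + 1 by rewrite ltr_wpDl.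
apply: le_trans (h (d / (`|K| + 1)) (divr_gt0 d0 K0)) _.
rewrite mulrAC ler_pdivrMr // ler_wpM2l ?(ltW d0) //.
by rewrite (le_trans (ler_norm _)) // lerDl.
Qed.

End Tangents.

(** * Order, symmetry and square roots for operator powers *)

Section OpPow2.
Variables (R : realType) (H : completeNormedModType R[i]).
Variables (dot : {dot H for Num.Def.conjC}) (Hdot : hilbert_norm dot).
Local Notation rip := (redot dot).

Lemma rip_closel (u v z : H) e : rnorm (u - v) <= e -> `|rip u z - rip v z| <= e * rnorm z.
Proof.
move=> h; rewrite -ripNl -ripDl; apply: le_trans (rip_le Hdot _ _) _.
by rewrite ler_wpM2r ?rnorm_ge0.
Qed.

Section OnePow.
Variables (T : {linear H -> H}) (p : R).
Hypotheses (sT : symop dot T) (T_ge0 : forall x, 0 <= rip (T x) x)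
  (bT : bounded_op T) (p0 : 0 < p).
Local Notation N := (opnorm T).
Local Notation S := (op_pow p T).

Lemma op_pow_rip_approx (M e : R) : 0 < e -> exists q : {poly R},
  (forall t, 0 <= t <= M -> `|q.[t] - t `^ p| <= e) /\
  forall x y, `|rip (op_poly q T x) y - rip (S x) y| <= e * (rnorm x * rnorm y).
Proof.
move=> e0; have [q [h1 h2]] := op_pow_approx Hdot sT T_ge0 bT p0 M e0.
by exists q; split => // x y; rewrite mulrA; apply: rip_closel.
Qed.

Lemma op_pow_sym : symop dot S.
Proof.
move=> x y; apply/eqP; rewrite -subr_eq0 -normr_le0.
apply: (@le0_of_eps _ _ (2 * (rnorm x * rnorm y))) => e e0.
have [q [_ hq]] := op_pow_rip_approx 0 e0.
have := hq x y; have := hq y x; rewrite -(ripC _ y) -(op_poly_sym sT).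
rewrite (ripC _ (S y)) (mulrC (rnorm y)) => /ler_normlP[h1 h2] /ler_normlP[h3 h4].
by apply/ler_normlP; split; lra.
Qed.

Lemma op_pow_bounded : exists2 K : R, 0 <= K & forall x, rnorm (S x) <= K * rnorm x.
Proof.
have [q [_ hq]] := op_pow_approx Hdot sT T_ge0 bT p0 0 ltr01.
have [N0 hN] := opnormP bT.
have [C C0 hC] := op_poly_bound N0 hN q.
exists (C + 1) => [|x]; first by rewrite addr_ge0.
have -> : S x = op_poly q T x - (op_poly q T x - S x) by rewrite opprB addrC subrK.
by apply: le_trans (rnormB _ _) _; rewrite mulrDl lerD.
Qed.

Lemma op_pow_le_poly (r : {poly R}) : (forall t, 0 <= t <= N -> t `^ p <= r.[t]) ->
  forall x, rip (S x) x <= rip (op_poly r T x) x.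
Proof.
move=> hr x; rewrite -subr_le0.
apply: (@le0_of_eps _ _ (2 * (rnorm x * rnorm x))) => e e0.
have [q [h1 h2]] := op_pow_rip_approx N e0.
have [N0 hN] := opnormP bT.
have := op_poly_le Hdot sT T_ge0 (rip_opnorm Hdot bT) N0 hN (p := q) (q := r + e%:P).
move=> /(_ _ x); rewrite op_polyD op_polyC !ripE (ripxx Hdot) expr2.
have := h2 x x => /ler_normlP[h3 h4] h5.
suff : rip (op_poly q T x) x <= rip (op_poly r T x) x + e * (rnorm x * rnorm x) by lra.
apply: h5 => t ht; rewrite hornerD hornerC.
by have := hr t ht; have := h1 t ht => /ler_normlP[]; lra.
Qed.

(** <S x, T x> stands for <T^(p+1) x, x>, in the shape produced by [op_pow_intertwine]. *)
Lemma op_pow_ge_poly (r : {poly R}) : (forall t, 0 <= t <= N -> r.[t] <= t * t `^ p) ->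
  forall x, rip (op_poly r T x) x <= rip (S x) (T x).
Proof.
move=> hr x; rewrite -subr_le0; have [N0 hN] := opnormP bT.
apply: (@le0_of_eps _ _ (rnorm x * rnorm (T x) + N * (rnorm x * rnorm x))) => e e0.
have [q [h1 h2]] := op_pow_rip_approx N e0.
have := op_poly_le Hdot sT T_ge0 (rip_opnorm Hdot bT) N0 hN
  (p := r) (q := 'X * q + (e * N)%:P).
move=> /(_ _ x); rewrite op_polyD op_polyM op_polyX op_polyC !ripE (ripxx Hdot) expr2.
have := h2 x (T x) => /ler_normlP[h3 h4] h5.
suff : rip (op_poly r T x) x <= rip (T (op_poly q T x)) x + e * N * (rnorm x * rnorm x).
  by rewrite sT; lra.
apply: h5 => t ht; rewrite hornerD hornerM hornerX hornerC.
have /andP[t0 tN] := ht.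
have := hr t ht; have := h1 t ht => /ler_normlP[h6 h7] h8.
have h9 : t * (t `^ p - q.[t]) <= N * e.
  by apply: le_trans (_ : t * e <= _); rewrite ?ler_wpM2l ?ler_wpM2r ?(ltW e0) //; lra.
lra.
Qed.

Lemma op_pow_ge0 x : 0 <= rip (S x) x.
Proof.
rewrite -oppr_le0; apply: (@le0_of_eps _ _ (2 * (rnorm x * rnorm x))) => e e0.
have [q [h1 h2]] := op_pow_rip_approx N e0.
have [N0 hN] := opnormP bT.
have := op_poly_le Hdot sT T_ge0 (rip_opnorm Hdot bT) N0 hN (p := (- e)%:P) (q := q).
move=> /(_ _ x); rewrite op_polyC !ripE (ripxx Hdot) expr2.
have := h2 x x => /ler_normlP[h3 h4] h5.
suff : - e * (rnorm x * rnorm x) <= rip (op_poly q T x) x by lra.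
apply: h5 => t ht; rewrite hornerC.
by have := h1 t ht => /ler_normlP[]; have := powR_ge0 t p; lra.
Qed.

End OnePow.

Lemma op_pow_half (T : {linear H -> H}) (p : R) :
  symop dot T -> (forall x, 0 <= rip (T x) x) -> bounded_op T -> 0 < p ->
  forall x, op_pow (p / 2) T (op_pow (p / 2) T x) = op_pow p T x.
Proof.
move=> sT T_ge0 bT p0 x; have p20 : 0 < p / 2 by rewrite divr_gt0.
set S := op_pow (p / 2) T.
have [N0 hN] := opnormP bT.
have [K K0 hK] := op_pow_bounded sT T_ge0 bT p20.
have sS : symop dot S := op_pow_sym sT T_ge0 bT p20.
have sqE t : t `^ p = t `^ (p / 2) * t `^ (p / 2).
  by rewrite -expr2 -powR_mulrn ?powR_ge0 // -powRrM divfK // gt_eqF.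
pose D := opnorm T `^ (p / 2) *+ 2 + 1.
suff : rnorm (S (S x) - op_pow p T x) <= 0.
  by move=> h; apply/eqP; rewrite -subr_eq0 -rnorm_eq0 eq_le h rnorm_ge0.
apply: (@le0_of_eps _ _ (D * rnorm x + (K + 1) * rnorm x + K * rnorm x)) => e0' e0'0.
(* With e <= 1 the factor |q + t^(p/2)| is at most D, so q * q is within e D of t^p. *)
pose e := Num.min e0' 1.
have e0 : 0 < e by rewrite lt_min e0'0 ltr01.
have e1 : e <= 1 by rewrite ge_min lexx orbT.
have ee : e <= e0' by rewrite ge_min lexx.
have [q [h1 h2]] := op_pow_approx Hdot sT T_ge0 bT p20 (opnorm T) e0.
have D0 : 0 <= D by rewrite addr_ge0 // mulrn_wge0 // powR_ge0.
apply: le_trans (_ : e * (D * rnorm x + (K + 1) * rnorm x + K * rnorm x) <= _); last first.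
  have r0 := rnorm_ge0 x; apply: ler_wpM2r => //.
  have := mulr_ge0 D0 r0; have := mulr_ge0 K0 r0; lra.
have k1 : rnorm (op_poly (q * q) T x - op_pow p T x) <= e * D * rnorm x.
  apply: (op_pow_close Hdot sT T_ge0 bT p0) => t ht; rewrite hornerM sqE.
  have -> : q.[t] * q.[t] - t `^ (p / 2) * t `^ (p / 2) =
    (q.[t] - t `^ (p / 2)) * (q.[t] - t `^ (p / 2) + t `^ (p / 2) *+ 2) by ring.
  rewrite normrM; apply: ler_pM => //; first exact: h1.
  apply: le_trans (ler_normD _ _) _; rewrite /D addrC; apply: lerD.
    rewrite normrMn ger0_norm ?powR_ge0 // lerMn2r /=.
    by have /andP[t0 tN] := ht; rewrite powR_le // ltW.
  exact: le_trans (h1 t ht) e1.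
have k2 : rnorm (op_poly q T x) <= (K + 1) * rnorm x.
  have -> : op_poly q T x = S x + (op_poly q T x - S x) by rewrite addrC subrK.
  apply: le_trans (rnormD _ _) _; rewrite mulrDl lerD //.
  by apply: le_trans (h2 x) _; rewrite ler_wpM2r ?rnorm_ge0.
have k3 := h2 (op_poly q T x).
have k4 : rnorm (S (op_poly q T x - S x)) <= K * (e * rnorm x).
  by apply: le_trans (hK _) _; rewrite ler_wpM2l.
have -> : S (S x) - op_pow p T x = (op_poly (q * q) T x - op_pow p T x) -
    (op_poly q T (op_poly q T x) - S (op_poly q T x)) - S (op_poly q T x - S x).
  by rewrite (symopB Hdot sS) op_polyM !opprB [RHS]addrC [X in _ = _ + X]addrC !subrKA.
rewrite !mulrDr !mulrA; apply: le_trans (rnormB _ _) _; apply: lerD.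
  by apply: le_trans (rnormB _ _) _; apply: lerD => //; rewrite -mulrA; apply: le_trans k3 _; rewrite ler_wpM2l // ltW.
by rewrite (mulrC e) -mulrA.
Qed.

(* If the bottom mu of X - Y were negative, |Yx| <= |Xx| would give
   <(X - Y - mu)y,y> >= c |y|^2 for some c > 0, so mu would not be the bottom. *)
Lemma sqrt_monotone (X Y : H -> H) (K L : R) :
  symop dot X -> symop dot Y -> (forall x, 0 <= rip (X x) x) ->
  (forall x, 0 <= rip (Y x) x) -> 0 <= K -> 0 <= L ->
  (forall x, rnorm (X x) <= K * rnorm x) -> (forall x, rnorm (Y x) <= L * rnorm x) ->
  (forall x, rnorm (Y x) <= rnorm (X x)) -> forall x, rip (Y x) x <= rip (X x) x.
Proof.
move=> sX sY X_ge0 Y_ge0 K0 L0 hK hL YX x; rewrite leNgt; apply/negP => hx.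
pose D y := X y - Y y.
have hD y : rnorm (D y) <= (K + L) * rnorm y.
  by rewrite mulrDl; apply: le_trans (rnormB _ _) _; apply: lerD.
have KL0 : 0 <= K + L by rewrite addr_ge0.
have [||mu [mu0 hmu mu_max]] := @form_inf_lt0 _ _ _ Hdot (fun y => rip (D y) y) (K + L) x.
- move=> y; apply: le_trans (rip_le Hdot _ _) _.
  by rewrite (ripxx Hdot) expr2 mulrA ler_wpM2r ?rnorm_ge0.
- by rewrite /D !ripE subr_lt0.
pose Z y := D y - mu%:C *: y.
have ZE y : rip (Z y) y = rip (D y) y - mu * rip y y by rewrite /Z !ripE.
have sZ : symop dot Z by move=> y z; rewrite /Z /D !ripE sX sY.
have Z_ge0 y : 0 <= rip (Z y) y by rewrite ZE subr_ge0.
pose E := K + L - mu + 1; have E0 : 0 < E by rewrite /E; lra.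
have hE y : rnorm (Z y) <= E * rnorm y.
  apply: le_trans (rnormB _ _) _; rewrite rnormZ (ltr0_norm mu0).
  by have := hD y; have := rnorm_ge0 y; rewrite /E; lra.
have CS := pos_CS Hdot sZ Z_ge0 (ltW E0) hE.
have F0 : 0 < K + L + 1 by lra.
(* c is the ratio left by mu^2 / 2 |y|^2 <= (- mu + (K + L + 1)^2 E / (2 mu^2)) <Z y, y>. The other
   half of mu^2 |y|^2 absorbs the cross term |Z y| |y|. *)
pose c := mu ^+ 2 / 2 / (- mu + (K + L + 1) ^+ 2 * E / (2 * mu ^+ 2)).
have mu2 : 0 < mu ^+ 2 by rewrite exprn_even_gt0 //= lt_eqF.
have den : 0 < - mu + (K + L + 1) ^+ 2 * E / (2 * mu ^+ 2).
  by rewrite addr_gt0 ?oppr_gt0 // divr_gt0 // mulr_gt0 // exprn_gt0.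
apply: (mu_max c) => [|y]; first by rewrite /c divr_gt0 // divr_gt0.
rewrite mulrDl -lerBrDl -ZE /c mulrAC ler_pdivrMr //.
(* |Xy|^2 - |Yy|^2 = <Dy, (X + Y)y> with D = Z + mu *)
have h1 : 0 <= rip (Z y) (X y + Y y) + mu * (rip (X y) y + rip (Y y) y).
  have -> : rip (Z y) (X y + Y y) + mu * (rip (X y) y + rip (Y y) y) =
     rnorm (X y) ^+ 2 - rnorm (Y y) ^+ 2.
    by rewrite /Z /D -!(ripxx Hdot) !ripE (ripC _ (Y y) (X y)) !(ripC _ y); ring.
  by rewrite subr_ge0 ler_sqr ?nnegrE ?rnorm_ge0.
have h2 : rip (Z y) (X y + Y y) <= rnorm (Z y) * ((K + L + 1) * rnorm y).
  apply: le_trans (ler_norm _) _; apply: le_trans (rip_le Hdot _ _) _.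
  rewrite ler_wpM2l ?rnorm_ge0 //; apply: le_trans (rnormD _ _) _.
  by have := hK y; have := hL y; have := rnorm_ge0 y; lra.
(* Where <Z y, y> is small, <D y, y> is close to mu |y|^2, and X >= 0 then pushes <(X + Y) y, y> up
   to about - mu |y|^2. *)
have h3 : - mu * rip y y <= rip (Z y) y + (rip (X y) y + rip (Y y) y).
  by rewrite ZE /D !ripE; have := X_ge0 y; lra.
have h4 : mu ^+ 2 * rip y y <= - mu * rip (Z y) y + rnorm (Z y) * ((K + L + 1) * rnorm y).
  by nra.
have h5 : rnorm (Z y) * ((K + L + 1) * rnorm y) <=
    mu ^+ 2 / 2 * rip y y + (K + L + 1) ^+ 2 / (2 * mu ^+ 2) * rnorm (Z y) ^+ 2.
  rewrite (ripxx Hdot) -subr_ge0.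
  have -> : mu ^+ 2 / 2 * rnorm y ^+ 2 + (K + L + 1) ^+ 2 / (2 * mu ^+ 2) * rnorm (Z y) ^+ 2 -
    rnorm (Z y) * ((K + L + 1) * rnorm y) =
    2^-1 * (mu * rnorm y - (K + L + 1) / mu * rnorm (Z y)) ^+ 2 by field; rewrite lt_eqF.
  by rewrite mulr_ge0 ?sqr_ge0 // invr_ge0.
have h6 : (K + L + 1) ^+ 2 / (2 * mu ^+ 2) * rnorm (Z y) ^+ 2 <=
    (K + L + 1) ^+ 2 / (2 * mu ^+ 2) * (E * rip (Z y) y).
  by rewrite ler_wpM2l // divr_ge0 ?sqr_ge0 // mulr_ge0 ?sqr_ge0.
rewrite mulrDr [_ * (_ / _)](_ : _ = (K + L + 1) ^+ 2 / (2 * mu ^+ 2) * (E * rip (Z y) y)); last by ring.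
by lra.
Qed.

End OpPow2.

(** * Localization along the spectrum *)

Lemma sqr_sum_le (R : realType) n (a : 'I_n -> R) :
  (\sum_(i < n) a i) ^+ 2 <= (\sum_(i < n) a i ^+ 2) * n%:R.
Proof.
apply: discr_le => [|s]; first by rewrite ler0n.
have : 0 <= \sum_(i < n) (a i - s) ^+ 2 by apply: sumr_ge0 => i _; exact: sqr_ge0.
congr (_ <= _); transitivity (\sum_(i < n) (a i ^+ 2 + - (2 * s) * a i + s ^+ 2)).
  by apply: eq_bigr => i _; ring.
by rewrite !big_split /= -mulr_sumr sumr_const card_ord mulNr mulr_natr.
Qed.

(* Degree N ^ 2 Bernstein polynomials grouped into N + 1 consecutive blocks:
   a polynomial partition of unity subordinate to the points M (i + 1) / N. *)
Section BlockPartition.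
Variables (R : realType) (M : R) (N : nat).
Hypotheses (M0 : 0 < M) (N0 : (0 < N)%N).

Definition block (i : nat) : {poly R} :=
  bern (M^-1 *: 'X) (N * N) (fun j => ((j %/ N)%N == i)%:R).
(** The shift i + 1 keeps every node positive, as scaling by powers of l requires. The last node
    exceeds M but is at most 2 M. *)
Definition node (i : nat) : R := M * (i.+1%:R / N%:R).

Let div_lt j : (j <= N * N)%N -> (j %/ N < N.+1)%N.
Proof. by move=> h; rewrite ltnS -{2}(mulnK N N0) leq_div2r. Qed.

Lemma block_sum : \sum_(i < N.+1) block i = 1.
Proof.
rewrite -bern_sum -[RHS](bern_cst (M^-1 *: 'X) (N * N)); apply: eq_bern => j jN.
rewrite (bigD1 (Ordinal (div_lt jN))) //= eqxx big1 ?addr0 // => i.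
by rewrite -val_eqE /= eq_sym => /negPf ->.
Qed.

(** Degree N^2 makes the standard deviation of the Bernstein weights at most M / N, which is also
    the block width, so both parts of the distance from t to the node are O(1/N). *)
Lemma block_sqdist t : 0 <= t <= M ->
  \sum_(i < N.+1) ((t - node i) * (block i).[t]) ^+ 2 <= (2 * M) ^+ 2 / N%:R ^+ 2.
Proof.
move=> tM; have NR : 0 < N%:R :> R by rewrite ltr0n.
have u01 : 0 <= M^-1 * t <= 1.
  have /andP[t0 tM'] := tM; rewrite mulr_ge0 ?invr_ge0 ?(ltW M0) //=.
  by rewrite mulrC ler_pdivrMr ?mul1r.
have blockE i : (block i).[t] = bern (M^-1 * t) (N * N) (fun j => ((j %/ N)%N == i)%:R).
  rewrite horner_bern hornerZ hornerX; apply: eq_bern => j _.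
  by case: (_ == _); rewrite ?hornerC ?horner0.
have block01 i : 0 <= (block i).[t] <= 1.
  rewrite blockE -[X in X <= bern _ _ _](bern_cst (M^-1 * t) (N * N)).
  rewrite -[X in _ && (_ <= X)](bern_cst (M^-1 * t) (N * N)).
  by rewrite !ler_bern // => j _; case: (_ == _); rewrite ?lexx ?ler01.
apply: le_trans (_ : \sum_(i < N.+1) (t - node i) ^+ 2 * (block i).[t] <= _).
  apply: ler_sum => i _; rewrite exprMn ler_wpM2l ?sqr_ge0 //.
  by have /andP[? ?] := block01 i; rewrite expr2 ler_piMr.
under eq_bigr do rewrite blockE -bernZ; rewrite -bern_sum.
have dist j : (j <= N * N)%N ->
    \sum_(i < N.+1) (t - node i) ^+ 2 * ((j %/ N)%N == i)%:R <=
    2 * (M * (j%:R / (N * N)%:R) - t) ^+ 2 + 2 * (M / N%:R) ^+ 2.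
  move=> jN; rewrite (bigD1 (Ordinal (div_lt jN))) //= eqxx big1 ?addr0 => [|i]; last first.
    by rewrite -val_eqE /= eq_sym => /negPf ->; rewrite mulr0.
  rewrite mulr1; set x := M * _.
  have hx : (x - node (j %/ N)) ^+ 2 <= (M / N%:R) ^+ 2.
    have -> : x - node (j %/ N) = - (M / N%:R) * (1 - (j %% N)%:R / N%:R).
      rewrite /x /node {1}(divn_eq j N) natrD !natrM -natr1.
      by field; rewrite gt_eqF.
    have r0 : 0 <= (j %% N)%:R / N%:R :> R by rewrite divr_ge0.
    have r1 : (j %% N)%:R / N%:R <= 1 :> R.
      by rewrite ler_pdivrMr // mul1r ler_nat ltnW // ltn_pmod.
    rewrite exprMn sqrrN ler_piMr ?sqr_ge0 //.
    by move: r0 r1; set r := _ / _; nra.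
  by have := sqr_ge0 ((t - x) - (x - node (j %/ N))); nra.
apply: le_trans (ler_bern u01 dist) _.
rewrite bernD bernZ bern_cst.
have NN : (0 < N * N)%N by rewrite muln_gt0 N0.
have := bern_sqdist M0 tM NN; rewrite natrM => h.
have -> : (2 * M) ^+ 2 / N%:R ^+ 2 =
   2 * (M ^+ 2 / (N%:R * N%:R)) + 2 * (M / N%:R) ^+ 2 :> R by field; rewrite gt_eqF.
by rewrite lerD2r ler_wpM2l.
Qed.

End BlockPartition.

Section Locality.
Variables (R : realType) (H : completeNormedModType R[i]).
Variables (dot : {dot H for Num.Def.conjC}) (Hdot : hilbert_norm dot).
Local Notation rip := (redot dot).
Variables (T : {linear H -> H}) (M K : R).
Hypotheses (sT : symop dot T) (T_ge0 : forall x, 0 <= rip (T x) x)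
  (M_gt0 : 0 < M) (T_leM : forall x, rip (T x) x <= M * rip x x)
  (K_ge0 : 0 <= K) (T_leK : forall x, rnorm (T x) <= K * rnorm x).

(* Cutting x into N pieces of spectral width 1 / N makes the pieces of W x of
   size C / N in l2-sense, whence |W x| = O(N ^ (-1/2)). *)
Lemma locally_lipschitz_eq0 (W : H -> H) (C : R) :
  (forall x y, W (x + y) = W x + W y) -> 0 <= C ->
  (forall l, 0 < l <= 2 * M -> forall y, rnorm (W y) <= C * rnorm (T y - l%:C *: y)) ->
  forall x, W x = 0.
Proof.
move=> WD C0 hW x.
have W0 : W 0 = 0 by have := WD 0 0; rewrite addr0 -[LHS]addr0 => /addrI.
apply/eqP; rewrite -rnorm_eq0 -sqrf_eq0 eq_le sqr_ge0 andbT.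
(* 8 M^2 is 2 (2 M)^2, where the 2 bounds (N + 1) / N. *)
apply: (@le0_of_eps _ _ (C ^+ 2 * (8 * M ^+ 2 * rip x x))) => e e0.
have [n hn] := exists_invS_le e0; have {hn} := hn n (leqnn _).
set N := n.+1 => hN; have N0 : (0 < N)%N by [].
have NR : 0 < N%:R :> R by rewrite ltr0n.
pose v i := rnorm (op_poly (('X - (node M N i)%:P) * block M N i) T x).
have Wx : rnorm (W x) <= \sum_(i < N.+1) C * v i.
  have {1}-> : x = \sum_(i < N.+1) op_poly (block M N i) T x.
    by rewrite -op_poly_sum block_sum // op_poly1.
  rewrite (big_morph W WD W0); apply: le_trans (rnorm_sum _ _) _.
  apply: ler_sum => i _; rewrite /v op_polyM op_polyB op_polyX op_polyC.
  apply: hW; rewrite /node mulr_gt0 ?divr_gt0 //=.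
  rewrite mulrC ler_pM2r // ler_pdivrMr // -natrM ler_nat.
  by have := ltn_ord i; rewrite mul2n -addnn => h; rewrite (leq_trans h) // -addn1 leq_add2l.
(* The squares are summed as one polynomial in T before being estimated. Bounding the N + 1 terms
   one by one would lose a factor N + 1 and with it the conclusion. *)
have vsum : \sum_(i < N.+1) v i ^+ 2 <= (2 * M) ^+ 2 / N%:R ^+ 2 * rip x x.
  have -> : \sum_(i < N.+1) v i ^+ 2 =
    rip (op_poly (\sum_(i < N.+1) (('X - (node M N i)%:P) * block M N i) ^+ 2) T x) x.
    rewrite op_poly_sum (big_morph (rip^~ x) (fun y z => ripDl dot y z x) (rip0l dot x)).
    apply: eq_bigr => i _; rewrite expr2 op_polyM (op_poly_sym sT).
    by rewrite (ripxx Hdot).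
  rewrite -ripZl -(op_polyC T); apply: (op_poly_le Hdot sT T_ge0 T_leM K_ge0 T_leK).
  move=> t tM; rewrite horner_sum hornerC.
  apply: le_trans (block_sqdist M_gt0 N0 tM); rewrite le_eqVlt; apply/orP; left.
  by apply/eqP/eq_bigr => i _; rewrite !hornerE.
have hsq : rnorm (W x) ^+ 2 <= C ^+ 2 * (((2 * M) ^+ 2 / N%:R ^+ 2 * rip x x) * N.+1%:R).
  apply: le_trans (_ : (\sum_(i < N.+1) C * v i) ^+ 2 <= _).
    have S0 := le_trans (rnorm_ge0 (W x)) Wx.
    by rewrite ler_sqr ?nnegrE ?rnorm_ge0.
  rewrite -mulr_sumr exprMn ler_wpM2l ?sqr_ge0 //.
  by apply: le_trans (sqr_sum_le _) _; rewrite ler_wpM2r.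
apply: le_trans hsq _.
have -> : C ^+ 2 * (((2 * M) ^+ 2 / N%:R ^+ 2 * rip x x) * N.+1%:R) =
   (N.+1%:R / (2 * N%:R)) * N%:R^-1 * (C ^+ 2 * (8 * M ^+ 2 * rip x x)).
  by field; rewrite gt_eqF.
apply: ler_wpM2r.
  apply: mulr_ge0; first exact: sqr_ge0.
  by apply: mulr_ge0 (rip_ge0 Hdot x); apply: mulr_ge0 => //; exact: sqr_ge0.
apply: le_trans hN; rewrite ger_pMl ?invr_gt0 //.
rewrite ler_pdivrMr ?mulr_gt0 // mul1r -natrM ler_nat.
by rewrite mul2n -addnn -addn1 leq_add2l.
Qed.

End Locality.

(** * p-hyponormal operators are paranormal *)

Section Convexity.
Variables (R : realType) (b : nat -> R).
Hypothesis b_convex : forall k, 2 * b k.+1 <= b k.+2 + b k.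

Let b_step j m : b j.+1 - b j <= b (j + m).+1 - b (j + m).
Proof.
elim: m => [|m IH]; first by rewrite addn0.
by rewrite addnS; have := b_convex (j + m); lra.
Qed.

Lemma convex_lower j : b 0 + j%:R * (b 1 - b 0) <= b j.
Proof.
elim: j => [|j IH]; first by rewrite mul0r addr0.
by rewrite -natr1; have := b_step 0 j; rewrite !add0n; lra.
Qed.

(** The j increments after index 1 are at most b (j+1) - b j and the next m are at least that;
    comparing the two sums gives the chord from 1 to j + m + 1. *)
Lemma convex_chord j m :
  (j + m)%:R * b j.+1 <= m%:R * b 1 + j%:R * b (j + m).+1.
Proof.
have h1 : b j.+1 - b 1 <= j%:R * (b j.+1 - b j).
  elim: j {m} => [|j IH]; first by rewrite subrr mul0r.
  have := ler_wpM2l (ler0n R j) (b_step j 1); rewrite addn1 -natr1.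
  by have := b_step j 1; rewrite addn1; lra.
have h2 : m%:R * (b j.+1 - b j) <= b (j + m).+1 - b j.+1.
  elim: m => [|m IH]; first by rewrite mul0r addn0 subrr.
  by rewrite -natr1; have := b_step j m.+1; rewrite addnS; lra.
have := ler_wpM2l (ler0n R m) h1; have := ler_wpM2l (ler0n R j) h2.
by rewrite natrD; lra.
Qed.

End Convexity.

(** * Tangent-line remainders of monomials *)

Section TangentPoly.
Variable R : realType.

(* The remainder of t ^ (k + 1) at its tangent line at l. *)
Definition tpoly (k : nat) (l : R) : {poly R} :=
  'X^(k.+1) - (k.+1%:R * l ^+ k) *: 'X + (k%:R * l ^+ k.+1)%:P.

Lemma horner_tpoly k l t :
  (tpoly k l).[t] = t ^+ k.+1 - k.+1%:R * l ^+ k * t + k%:R * l ^+ k.+1.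
Proof. by rewrite /tpoly !hornerE. Qed.

(** Multiplying the remainder by t gives the next one up to (k + 1) l^k (t - l)^2, so the constant
    is uniform in l. *)
Lemma tpoly_bound (M L : R) k : 0 <= M -> 0 <= L -> exists2 C : R, 0 <= C &
  forall l t, 0 <= l <= L -> 0 <= t <= M -> `|(tpoly k l).[t]| <= C * (t - l) ^+ 2.
Proof.
move=> M0 L0; elim: k => [|k [C C0 hC]].
  exists 0 => // l t _ _; rewrite horner_tpoly expr1 expr0 !mul0r addr0 !mul1r.
  by rewrite subrr normr0.
exists (M * C + k.+1%:R * L ^+ k) => [|l t lL tM].
  by rewrite addr_ge0 // mulr_ge0 ?exprn_ge0.
have -> : (tpoly k.+1 l).[t] = t * (tpoly k l).[t] + k.+1%:R * l ^+ k * (t - l) ^+ 2.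
  rewrite !horner_tpoly !exprS -!natr1; ring.
have /andP[l0 lL'] := lL; have /andP[t0 tM'] := tM.
apply: le_trans (ler_normD _ _) _; rewrite mulrDl; apply: lerD.
  by rewrite normrM -mulrA ger0_norm //; apply: ler_pM => //; exact: hC.
rewrite ger0_norm; last by apply: mulr_ge0 (sqr_ge0 _); rewrite mulr_ge0 ?exprn_ge0.
by rewrite ler_wpM2r ?sqr_ge0 // ler_wpM2l // lerXn2r ?nnegrE // (le_trans l0).
Qed.

Lemma exprB_bound (M L : R) k : 0 <= M -> 0 <= L -> exists2 C : R, 0 <= C &
  forall l t, 0 <= l <= L -> 0 <= t <= M -> `|t ^+ k - l ^+ k| <= C * `|t - l|.
Proof.
move=> M0 L0; elim: k => [|k [C C0 hC]].
  by exists 0 => // l t _ _; rewrite !expr0 subrr normr0 mul0r.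
exists (M * C + L ^+ k) => [|l t lL tM].
  by rewrite addr_ge0 ?mulr_ge0 ?exprn_ge0.
have -> : t ^+ k.+1 - l ^+ k.+1 = t * (t ^+ k - l ^+ k) + l ^+ k * (t - l).
  by rewrite !exprS; ring.
have /andP[l0 lL'] := lL; have /andP[t0 tM'] := tM.
apply: le_trans (ler_normD _ _) _; rewrite !normrM mulrDl; apply: lerD.
  by rewrite -mulrA ger0_norm //; apply: ler_pM => //; exact: hC.
rewrite ger0_norm ?exprn_ge0 // ler_wpM2r // lerXn2r ?nnegrE //.
Qed.

End TangentPoly.

(** * From powers of P and Q to the paranormal inequality *)

Section Main.
Variables (R : realType) (H : completeNormedModType R[i]).
Variables (dot : {dot H for Num.Def.conjC}) (Hdot : hilbert_norm dot).
Local Notation rip := (redot dot).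
Variables (A B : {linear H -> H}).
Hypotheses (bA : bounded_op A) (bB : bounded_op B)
  (AB : forall x y, rip (A x) y = rip x (B y)).

Lemma adj_sym x y : rip (B x) y = rip x (A y).
Proof. by rewrite ripC -AB ripC. Qed.

Local Notation P := (B \o A : {linear H -> H}).
Local Notation Q := (A \o B : {linear H -> H}).

Lemma bounded_comp (S T : H -> H) : bounded_op S -> bounded_op T -> bounded_op (S \o T).
Proof.
move=> /boundedP [K K0 hK] /boundedP [L L0 hL]; exists (K * L) => x /=.
rewrite !rnormE -rmorphM lecR -mulrA; apply: le_trans (hK _) _.
by rewrite ler_wpM2l.
Qed.

Lemma P_sym : symop dot P. Proof. by move=> x y /=; rewrite adj_sym AB. Qed.
Lemma Q_sym : symop dot Q. Proof. by move=> x y /=; rewrite AB adj_sym. Qed.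
Lemma P_ge0 x : 0 <= rip (P x) x. Proof. by rewrite /= adj_sym rip_ge0. Qed.
Lemma Q_ge0 x : 0 <= rip (Q x) x. Proof. by rewrite /= AB rip_ge0. Qed.
Lemma P_bounded : bounded_op P. Proof. exact: bounded_comp. Qed.
Lemma Q_bounded : bounded_op Q. Proof. exact: bounded_comp. Qed.

Definition phyp p := forall x, rip (op_pow p Q x) x <= rip (op_pow p P x) x.

(** Squaring the half powers, the hypothesis reads |Q^(p/2) x| <= |P^(p/2) x|, which is what
    [sqrt_monotone] asks for. *)
Lemma phyp_half p : 0 < p -> phyp p -> phyp (p / 2).
Proof.
move=> p0 hp; have p20 : 0 < p / 2 by rewrite divr_gt0.
have [K K0 hK] := op_pow_bounded Hdot P_sym P_ge0 P_bounded p20.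
have [L L0 hL] := op_pow_bounded Hdot Q_sym Q_ge0 Q_bounded p20.
have sP := op_pow_sym Hdot P_sym P_ge0 P_bounded p20.
have sQ := op_pow_sym Hdot Q_sym Q_ge0 Q_bounded p20.
apply: (sqrt_monotone Hdot sP sQ _ _ K0 L0 hK hL).
- exact: (op_pow_ge0 Hdot P_sym P_ge0 P_bounded p20).
- exact: (op_pow_ge0 Hdot Q_sym Q_ge0 Q_bounded p20).
move=> x; rewrite -ler_sqr ?nnegrE ?rnorm_ge0 // -!(ripxx Hdot) -sP -sQ.
by rewrite (op_pow_half Hdot P_sym P_ge0 P_bounded p0) (op_pow_half Hdot Q_sym Q_ge0 Q_bounded p0).
Qed.

(** Repeated halving reaches (0, 1], where t^p is concave and lies below its tangents. *)
Lemma phyp_le1 p : 0 < p -> phyp p -> exists2 q, 0 < q <= 1 & phyp q.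
Proof.
move=> p0 hp; have [n hn] : exists n, p <= 2 ^+ n.
  exists (Num.truncn p).+1; apply: le_trans (ltW (truncnS_gt p)) _.
  by rewrite -natrX ler_nat ltnW // ltn_expl.
elim: n p p0 hp hn => [|n IH] p p0 hp hn; first by exists p => //; rewrite p0.
apply: (IH (p / 2)); [by rewrite divr_gt0|exact: phyp_half|].
by rewrite ler_pdivrMr // -exprSr.
Qed.

Lemma op_poly_intertwine q x : op_poly q Q (A x) = A (op_poly q P x).
Proof.
rewrite /op_poly linear_sum; apply: eq_bigr => i _; rewrite linearZ /=; congr (_ *: _).
by elim: (nat_of_ord i) => //= n ->.
Qed.

(** Turns <Q^p A x, A x> into <P^p x, P x>, a quantity in P alone. *)
Lemma op_pow_intertwine p x : 0 < p -> op_pow p Q (A x) = A (op_pow p P x).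
Proof.
move=> p0; have [K K0 hK] := boundedP bA.
suff : rnorm (op_pow p Q (A x) - A (op_pow p P x)) <= 0.
  by move=> h; apply/eqP; rewrite -subr_eq0 -rnorm_eq0 eq_le h rnorm_ge0.
apply: (@le0_of_eps _ _ (rnorm (A x) + K * rnorm x)) => e e0.
have [q [h1 h2]] := op_pow_approx Hdot P_sym P_ge0 P_bounded p0 (opnorm Q) e0.
have h3 := op_pow_close Hdot Q_sym Q_ge0 Q_bounded p0 h1 (A x).
rewrite -(subrKA (op_poly q Q (A x))); apply: le_trans (rnormD _ _) _.
rewrite mulrDr; apply: lerD; first by rewrite rnormC.
rewrite op_poly_intertwine -linearB; apply: le_trans (hK _) _.
by rewrite mulrCA ler_wpM2l.
Qed.

Lemma phyp_paranormal p : 0 < p <= 1 -> phyp p -> forall l x, 0 < l ->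
  2 * l * rnorm (A x) ^+ 2 <= rnorm (A (A x)) ^+ 2 + l ^+ 2 * rnorm x ^+ 2.
Proof.
move=> p01 hp l x l0; have /andP[p0 p1] := p01.
have m0 : 0 < l `^ (p - 1) by rewrite powR_gt0.
have lE : l `^ p = l * l `^ (p - 1) by rewrite mulr_powRB1 // ltW.
have up : rip (op_pow p P (A x)) (A x) <=
    (1 - p) * l `^ p * rnorm (A x) ^+ 2 + p * l `^ (p - 1) * rnorm (A (A x)) ^+ 2.
  apply: le_trans (op_pow_le_poly Hdot P_sym P_ge0 P_bounded p0
    (r := ((1 - p) * l `^ p)%:P + (p * l `^ (p - 1)) *: 'X) _ (A x)) _.
    by move=> t /andP[t0 _]; rewrite hornerD hornerZ hornerX hornerC; exact: tangent_powR.
  by rewrite op_polyD op_polyC op_polyZ op_polyX !ripE /= adj_sym !(ripxx Hdot).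
have low : (p + 1) * l `^ p * rnorm (A x) ^+ 2 - p * (l `^ p * l) * rnorm x ^+ 2 <=
    rip (op_pow p Q (A x)) (A x).
  rewrite op_pow_intertwine // AB.
  apply: le_trans (op_pow_ge_poly Hdot P_sym P_ge0 P_bounded p0
    (r := ((p + 1) * l `^ p) *: 'X - (p * (l `^ p * l))%:P) _ x).
    by rewrite op_polyB op_polyC op_polyZ op_polyX !ripE /= adj_sym !(ripxx Hdot).
  by move=> t /andP[t0 _]; rewrite hornerD hornerN hornerZ hornerX hornerC; exact: tangent_mul_powR.
(* The coefficients p + 1 and 1 - p of l^p |A x|^2 differ by 2 p, and p l^(p-1) is then a common
   factor. *)
have := le_trans low (le_trans (hp (A x)) up); rewrite lE => h.
have pm0 : 0 < p * l `^ (p - 1) by rewrite mulr_gt0.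
rewrite -subr_ge0 -(pmulr_rge0 _ pm0).
move: h; move: (l `^ (p - 1)) (rnorm _ ^+ 2) (rnorm _ ^+ 2) (rnorm _ ^+ 2) => m a b c; lra.
Qed.

End Main.

(** * Moments of paranormal operators *)

Section Main2.
Variables (R : realType) (H : completeNormedModType R[i]).
Variables (dot : {dot H for Num.Def.conjC}) (Hdot : hilbert_norm dot).
Local Notation rip := (redot dot).
Variables (A B : {linear H -> H}).
Hypotheses (bA : bounded_op A) (bB : bounded_op B)
  (AB : forall x y, rip (A x) y = rip x (B y)).

Local Notation P := (B \o A : {linear H -> H}).
Local Notation Q := (A \o B : {linear H -> H}).

Let sP := P_sym AB.
Let gP := P_ge0 Hdot AB.
Let bP := P_bounded bA bB.

Definition moment k x := iter k B (iter k A x).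

Lemma iter_adj k x y : rip (iter k B x) y = rip x (iter k A y).
Proof. by elim: k x y => // k IH x y; rewrite iterSr IH (adj_sym AB). Qed.

Lemma moment_sym k : symop dot (moment k).
Proof. by move=> x y; rewrite /moment iter_adj (ripC _ x) iter_adj ripC. Qed.

Lemma moment_norm k x : rip (moment k x) x = rnorm (iter k A x) ^+ 2.
Proof. by rewrite iter_adj (ripxx Hdot). Qed.

Lemma moment_bounded k : exists2 C : R, 0 <= C & forall x, rnorm (moment k x) <= C * rnorm x.
Proof.
have [K K0 hK] := boundedP bA; have [L L0 hL] := boundedP bB.
exists (L ^+ k * K ^+ k) => [|x]; first by rewrite mulr_ge0 ?exprn_ge0.
apply: le_trans (iter_bound L0 hL _ _) _; rewrite -mulrA ler_wpM2l ?exprn_ge0 //.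
exact: iter_bound.
Qed.

(** |P^(k+1) x|^2 = <P^k x, P^(k+2) x>, so the exponent descends to 1, where |A x|^2 = <x, P x>. *)
Lemma iterP_eq0 k x : iter k P x = 0 -> A x = 0.
Proof.
move=> h; have : P x = 0.
  elim: k h => [|[//|k] IH] h; first by rewrite (_ : x = 0) ?linear0.
  apply: IH; apply: (rip_eq0 Hdot); rewrite {1}iterS sP.
  by rewrite -/(iter k.+2 P x) h rip0r.
by move=> Px; apply: (rip_eq0 Hdot); rewrite AB [B _]Px rip0r.
Qed.

Hypothesis paranormal : forall (l : R) x, 0 < l ->
  2 * l * rnorm (A x) ^+ 2 <= rnorm (A (A x)) ^+ 2 + l ^+ 2 * rnorm x ^+ 2.

Section Scalars.
Variables (l : R) (l0 : 0 < l) (x : H).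
Let a k := rnorm (iter k A x) ^+ 2.

Let u := l^-1.

Let lu k : l ^+ k * u ^+ k = 1.
Proof. by rewrite -exprMn mulfV ?expr1n // gt_eqF. Qed.

Let scaled_convex k :
  2 * (a k.+1 * u ^+ k.+1) <= a k.+2 * u ^+ k.+2 + a k * u ^+ k.
Proof.
have uk : 0 <= u ^+ k.+2 by rewrite exprn_ge0 // invr_ge0 ltW.
have := ler_wpM2r uk (paranormal (iter k A x) l0).
rewrite -!iterS -/(a k) -/(a k.+1) -/(a k.+2).
have e1 : u ^+ k.+1 = l * u ^+ k.+2 by rewrite [in RHS]exprS mulrA -[l]expr1 -[u in _ * u]expr1 lu mul1r.
have e2 : u ^+ k = l * u ^+ k.+1 by rewrite [in RHS]exprS mulrA -[l]expr1 -[u in _ * u]expr1 lu mul1r.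
rewrite e2 e1; lra.
Qed.

Lemma moment_lower j :
  j.+1%:R * l ^+ j * a 1 - j%:R * l ^+ j.+1 * a 0 <= a j.+1.
Proof.
have lk : 0 <= l ^+ j.+1 by rewrite exprn_ge0 // ltW.
have := ler_wpM2r lk (convex_lower scaled_convex j.+1).
have e1 : u * l ^+ j.+1 = l ^+ j by rewrite exprS mulrA mulVf ?mul1r // gt_eqF.
rewrite -[a j.+1 * _ * _]mulrA [u ^+ _ * _]mulrC lu mulr1 expr0 expr1 mulr1.
apply: le_trans; rewrite le_eqVlt; apply/orP; left; apply/eqP.
have -> : (a 0 + j.+1%:R * (a 1 * u - a 0)) * l ^+ j.+1 =
  j.+1%:R * a 1 * (u * l ^+ j.+1) + (1 - j.+1%:R) * (a 0 * l ^+ j.+1) by ring.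
by rewrite e1 -natr1; ring.
Qed.

(** When the moment of order j + m + 1 is a power of P, the right side is the form of m l^(j+m) t +
    j t^(j+m+1) at P. This function has the same value and slope at t = l as (j + m) l^m t^(j+1). *)
Lemma moment_chord j m :
  (j + m)%:R * l ^+ m * a j.+1 <= m%:R * l ^+ (j + m) * a 1 + j%:R * a (j + m).+1.
Proof.
have lk : 0 <= l ^+ (j + m).+1 by rewrite exprn_ge0 // ltW.
have := ler_wpM2r lk (convex_chord scaled_convex j m).
have e1 : u * l ^+ (j + m).+1 = l ^+ (j + m).
  by rewrite exprS mulrA mulVf ?mul1r // gt_eqF.
have e2 : u ^+ j.+1 * l ^+ (j + m).+1 = l ^+ m.
  by rewrite -addSn exprD mulrA (mulrC (u ^+ _)) lu mul1r.
have e3 : u ^+ (j + m).+1 * l ^+ (j + m).+1 = 1 by rewrite mulrC lu.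
have -> : (j + m)%:R * (a j.+1 * u ^+ j.+1) * l ^+ (j + m).+1 =
  (j + m)%:R * a j.+1 * (u ^+ j.+1 * l ^+ (j + m).+1) by ring.
have -> : (m%:R * (a 1 * u ^+ 1) + j%:R * (a (j + m).+1 * u ^+ (j + m).+1)) * l ^+ (j + m).+1 =
  m%:R * a 1 * (u * l ^+ (j + m).+1) +
  j%:R * a (j + m).+1 * (u ^+ (j + m).+1 * l ^+ (j + m).+1) by rewrite expr1; ring.
by rewrite e1 e2 e3; lra.
Qed.

End Scalars.

(** The added 1 keeps the interval nondegenerate when P = 0. *)
Let M := opnorm P + 1.
Let M0 : 0 < M.
Proof. by have [N0 _] := opnormP bP; rewrite /M ltr_wpDl. Qed.
Let K0 : 0 <= opnorm P. Proof. by case: (opnormP bP). Qed.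
Let PK x : rnorm (P x) <= opnorm P * rnorm x. Proof. by have [_] := opnormP bP; exact. Qed.
Let PM x : rip (P x) x <= M * rip x x.
Proof.
apply: le_trans (rip_opnorm Hdot bP x) _.
by rewrite ler_wpM2r ?(rip_ge0 Hdot) // lerDl.
Qed.

Let P_norm_le (p q : {poly R}) : (forall t : R, 0 <= t <= M -> `|p.[t]| <= `|q.[t]|) ->
  forall x, rnorm (op_poly p P x) <= rnorm (op_poly q P x).
Proof. exact: (op_poly_norm_le Hdot sP gP PM K0 PK). Qed.

Let P_le (p q : {poly R}) : (forall t : R, 0 <= t <= M -> p.[t] <= q.[t]) ->
  forall x, rip (op_poly p P x) x <= rip (op_poly q P x) x.
Proof. exact: (op_poly_le Hdot sP gP PM K0 PK). Qed.

Let op_tpoly k (l : R) x : op_poly (tpoly k l) P x =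
  iter k.+1 P x - (k.+1%:R * l ^+ k)%:C *: P x + (k%:R * l ^+ k.+1)%:C *: x.
Proof. by rewrite op_polyD op_polyB op_polyXn op_polyZ op_polyX op_polyC. Qed.

Lemma moment_eq j m : (0 < j)%N ->
  (forall x, moment (j + m).+1 x = iter (j + m).+1 P x) ->
  forall x, moment j.+1 x = iter j.+1 P x.
Proof.
move=> j0 hn.
pose D y := moment j.+1 y - iter j.+1 P y.
(* [Y l] is S_(j+1) minus the tangent of t^(j+1) at l evaluated at P; [moment_lower] makes it
   positive. *)
pose Y l y := D y + op_poly (tpoly j l) P y.
have L0 : 0 <= 2 * M by rewrite mulr_ge0 // ltW.
have [C1 C10 hC1] := tpoly_bound (j + m) (ltW M0) L0.
have [C3 C30 hC3] := tpoly_bound j (ltW M0) L0.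
have [C4 C40 hC4] := exprB_bound m (ltW M0) L0.
have sD : symop dot D.
  by move=> x y; rewrite /D !ripE moment_sym (iter_sym sP).
have sY l : symop dot (Y l).
  by move=> x y; rewrite /Y ripDl sD (op_poly_sym sP) [RHS]ripDr.
have [KD KD0 hKD] : exists2 C : R, 0 <= C & forall x, rnorm (D x) <= C * rnorm x.
  have [C C0 hC] := moment_bounded j.+1.
  exists (C + opnorm P ^+ j.+1) => [|x]; first by rewrite addr_ge0 ?exprn_ge0.
  by rewrite mulrDl; apply: le_trans (rnormB _ _) _; apply: lerD => //; exact: iter_bound.
pose d l y := rnorm (P y - l%:C *: y).
(* One of the two factors t - l of the remainder is bounded by 3 M, leaving a bound linear in |(P -
   l) y|. *)
have tp_le l y : 0 < l <= 2 * M -> rnorm (op_poly (tpoly j l) P y) <= C3 * (3 * M) * d l y.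
  move=> /andP[l0 lM].
  have -> : C3 * (3 * M) * d l y = rnorm (op_poly ((C3 * (3 * M)) *: ('X - l%:P)) P y).
    rewrite op_polyZ op_polyB op_polyX op_polyC rnormZ ger0_norm //.
    by rewrite !mulr_ge0 // ltW.
  apply: P_norm_le => t tM; apply: le_trans (hC3 l t _ tM) _; first by rewrite (ltW l0).
  rewrite hornerZ hornerD hornerX hornerN hornerC normrM ger0_norm; last by rewrite !mulr_ge0 // ltW.
  rewrite -mulrA ler_wpM2l // -(real_normK (num_real (t - l))) expr2 ler_wpM2r //.
  by have /andP[t0 t1] := tM; apply/ler_normlP; split; lra.
have d_ge0 l y : 0 <= d l y by exact: rnorm_ge0.
have d_le l y : 0 < l <= 2 * M -> d l y <= (opnorm P + 2 * M) * rnorm y.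
  move=> /andP[l0 lM]; apply: le_trans (rnormB _ _) _; rewrite mulrDl lerD //.
  by rewrite rnormZ gtr0_norm // ler_wpM2r ?rnorm_ge0.
pose KY := KD + C3 * (3 * M) * (opnorm P + 2 * M).
have KY0 : 0 <= KY by rewrite addr_ge0 // !mulr_ge0 ?addr_ge0 // ltW.
have hKY l y : 0 < l <= 2 * M -> rnorm (Y l y) <= KY * rnorm y.
  move=> hl; apply: le_trans (rnormD _ _) _; rewrite mulrDl lerD //.
  apply: le_trans (tp_le l y hl) _; rewrite -[leRHS]mulrA ler_wpM2l ?d_le //.
  by rewrite !mulr_ge0 // ltW.
have YE l y : rip (Y l y) y = rnorm (iter j.+1 A y) ^+ 2 -
    (j.+1%:R * l ^+ j * rnorm (A y) ^+ 2 - j%:R * l ^+ j.+1 * rnorm y ^+ 2).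
  rewrite /Y /D op_tpoly !ripE moment_norm -(ripxx Hdot y).
  have -> : rip (P y) y = rnorm (A y) ^+ 2 by rewrite (adj_sym AB) (ripxx Hdot).
  by ring.
have Y_ge0 l y : 0 < l -> 0 <= rip (Y l y) y.
  by move=> l0; rewrite YE subr_ge0; exact: (moment_lower l0 y j).
(* Subtracting the tangent from the chord leaves (j + m) l^m <Y y, y> at most j times the form of
   [tpoly (j + m) l] at P, which is O(|(P - l) y|^2). *)
have Y_le l y : 0 < l <= 2 * M -> l ^+ m * rip (Y l y) y <= C1 * d l y ^+ 2.
  move=> /andP[l0 lM].
  have h1 : rip (op_poly (tpoly (j + m) l) P y) y <= C1 * d l y ^+ 2.
    have -> : C1 * d l y ^+ 2 = rip (op_poly (C1 *: (('X - l%:P) ^+ 2)) P y) y.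
      rewrite op_polyZ expr2 op_polyM ripZl (op_poly_sym sP) (ripxx Hdot).
      by rewrite op_polyB op_polyX op_polyC.
    apply: P_le => t tM; apply: le_trans (ler_norm _) _.
    apply: le_trans (hC1 l t _ tM) _; first by rewrite (ltW l0).
    by rewrite hornerZ horner_exp hornerD hornerX hornerN hornerC.
  have h2 : rip (op_poly (tpoly (j + m) l) P y) y = rnorm (iter (j + m).+1 A y) ^+ 2 -
      (j + m).+1%:R * l ^+ (j + m) * rnorm (A y) ^+ 2 + (j + m)%:R * l ^+ (j + m).+1 * rnorm y ^+ 2.
    rewrite op_tpoly !ripE -hn moment_norm -(ripxx Hdot y).
    by have -> : rip (P y) y = rnorm (A y) ^+ 2 by rewrite (adj_sym AB) (ripxx Hdot).
  have h3 := moment_chord l0 y j m.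
  have h4 : (j + m)%:R * (l ^+ m * rip (Y l y) y) <= j%:R * (C1 * d l y ^+ 2).
    apply: le_trans (_ : j%:R * rip (op_poly (tpoly (j + m) l) P y) y <= _); last first.
      by rewrite ler_wpM2l.
    rewrite h2 YE; move: h3; rewrite [iter 1 A y]/=.
    rewrite !exprS exprD -!natr1 natrD => h3; lra.
  have jR : 0 < j%:R :> R by rewrite ltr0n.
  rewrite -(ler_pM2l jR); apply: le_trans h4; rewrite ler_wpM2r //; last first.
    by rewrite ler_nat leq_addr.
  by rewrite mulr_ge0 ?exprn_ge0 ?Y_ge0 // ltW.
pose c := (2 * M) ^+ m * KY * C1.
have c0 : 0 <= c by rewrite !mulr_ge0 ?exprn_ge0.
(* Cauchy-Schwarz gives |Y y|^2 <= KY <Y y, y>. Of the weight l^(2m), one l^m goes to the form bound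
   and the other is at most (2 M)^m; c + 1 bounds the square root of c. *)
have Y_small l y : 0 < l <= 2 * M -> l ^+ m * rnorm (Y l y) <= (c + 1) * d l y.
  move=> hl; have /andP[l0 lM] := hl.
  have lm0 : 0 <= l ^+ m by rewrite exprn_ge0 // ltW.
  rewrite -ler_sqr ?nnegrE ?mulr_ge0 ?rnorm_ge0 ?addr_ge0 // !exprMn.
  have CS := pos_CS Hdot (sY l) (fun y => Y_ge0 l y l0) KY0 (fun y => hKY l y hl) y.
  apply: le_trans (_ : c * d l y ^+ 2 <= _); last first.
    by rewrite ler_wpM2r ?sqr_ge0 //; nra.
  apply: le_trans (_ : l ^+ m ^+ 2 * (KY * rip (Y l y) y) <= _).
    by rewrite ler_wpM2l ?sqr_ge0.
  have -> : l ^+ m ^+ 2 * (KY * rip (Y l y) y) = l ^+ m * KY * (l ^+ m * rip (Y l y) y).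
    by rewrite expr2; ring.
  rewrite /c -[leRHS]mulrA; apply: ler_pM; rewrite ?mulr_ge0 ?Y_ge0 ?Y_le //.
  by rewrite ler_wpM2r // lerXn2r ?nnegrE // ltW.
(* The weight l^m is exchanged for P^m at the cost of t^m - l^m, itself Lipschitz-small at l. *)
have W0 x : D (iter m P x) = 0.
  pose C := c + 1 + (2 * M) ^+ m * (C3 * (3 * M)) + KD * C4.
  apply: (@locally_lipschitz_eq0 _ _ _ Hdot P M _ sP gP M0 PM K0 PK (fun y => D (iter m P y)) C).
  - by move=> y z; rewrite linearD (symopD Hdot sD).
  - by rewrite /C !addr_ge0 ?mulr_ge0 ?exprn_ge0 // ltW.
  move=> l hl y; have /andP[l0 lM] := hl; rewrite -/(d l y).
  have lm0 : 0 <= l ^+ m by rewrite exprn_ge0 // ltW.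
  have -> : D (iter m P y) = (l ^+ m)%:C *: D y + D (op_poly ('X^m - (l ^+ m)%:P) P y).
    by rewrite op_polyB op_polyXn op_polyC (symopB Hdot sD) (symopZ Hdot sD) addrC subrK.
  apply: le_trans (rnormD _ _) _; rewrite rnormZ ger0_norm // /C mulrDl; apply: lerD; last first.
    apply: le_trans (hKD _) _; rewrite -mulrA ler_wpM2l //.
    have -> : C4 * d l y = rnorm (op_poly (C4 *: ('X - l%:P)) P y).
      by rewrite op_polyZ op_polyB op_polyX op_polyC rnormZ ger0_norm.
    apply: P_norm_le => t tM; rewrite hornerZ !hornerD !hornerN hornerXn hornerX !hornerC.
    by rewrite normrM (ger0_norm C40) hC4 // (ltW l0).
  have -> : D y = Y l y - op_poly (tpoly j l) P y by rewrite /Y addrK.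
  rewrite mulrDl; apply: le_trans (_ : l ^+ m * (rnorm (Y l y) + rnorm (op_poly (tpoly j l) P y)) <= _).
    by rewrite ler_wpM2l // rnormB.
  rewrite mulrDr; apply: lerD; first exact: Y_small.
  rewrite -mulrA; apply: ler_pM; rewrite ?rnorm_ge0 ?tp_le //.
  by rewrite lerXn2r ?nnegrE // ltW.
move=> x; apply/eqP; rewrite -subr_eq0 -/(D x); apply/eqP; apply: (rip_eq0 Hdot).
(* By symmetry P^m D = 0 as well, so A D x = 0. Both terms of D begin by applying A, hence D (D x) =
   0 and |D x|^2 = <D (D x), x> = 0. *)
have PD : iter m P (D x) = 0.
  apply: (rip_all0 Hdot) => y.
  by rewrite (iter_sym sP) sD W0 rip0r.
have AD := iterP_eq0 PD.
have DD : D (D x) = 0.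
  rewrite {1}/D /moment !iterSr AD /= AD.
  have z n (T : {linear H -> H}) : iter n T 0 = 0 by elim: n => //= n ->; rewrite linear0.
  by rewrite !(z, linear0) addr0.
by rewrite -sD DD rip0l.
Qed.

Lemma quasinormal_of_moments n : (3 <= n)%N ->
  (forall x, moment n x = iter n P x) -> forall x, P (A x) = A (P x).
Proof.
move=> n3 hn x.
have m2 y : moment 2 y = iter 2 P y.
  by apply: (@moment_eq 1 (n - 2)) => //; rewrite (_ : (1 + (n - 2)).+1 = n) //; lia.
have m3 y : moment 3 y = iter 3 P y.
  by apply: (@moment_eq 2 (n - 3)) => //; rewrite (_ : (2 + (n - 3)).+1 = n) //; lia.
(* Each term in the expansion of |P A x - A P x|^2 equals <P^3 x, x>: the first through S_2 and S_3,
   the cross term through S_2, the last by symmetry alone. *)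
have e1 : rip (P (A x)) (P (A x)) = rip (iter 3 P x) x.
  rewrite -m3 -sP -[P (P (A x))]/(iter 2 P (A x)) -m2 -(adj_sym AB).
  by rewrite [moment 3 x]/(B (moment 2 (A x))).
have e2 : rip (P (A x)) (A (P x)) = rip (iter 3 P x) x.
  by rewrite -(adj_sym AB) -[B (P (A x))]/(moment 2 x) m2 -sP.
have e3 : rip (A (P x)) (A (P x)) = rip (iter 3 P x) x.
  by rewrite -(adj_sym AB) -[B (A (P x))]/(iter 2 P x) -sP.
apply/eqP; rewrite -subr_eq0; apply/eqP; apply: (rip_eq0 Hdot).
by rewrite !ripE (ripC _ (A (P x)) (P (A x))) e1 e2 e3; ring.
Qed.

End Main2.

(** * Quasinormality *)

Section Hypo.
Variables (R : realType) (H : completeNormedModType R[i]).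
Variables (dot : {dot H for Num.Def.conjC}) (Hdot : hilbert_norm dot).
Local Notation rip := (redot dot).

Lemma op_pow1 (T : {linear H -> H}) : symop dot T -> (forall x, 0 <= rip (T x) x) ->
  bounded_op T -> forall x, op_pow 1 T x = T x.
Proof.
move=> sT gT bT x; apply/esym/eqP; rewrite -subr_eq0 -rnorm_eq0 eq_le rnorm_ge0 andbT.
have := op_pow_close Hdot sT gT bT ltr01 (q := 'X) (e := 0) _ x.
rewrite op_polyX mul0r; apply => t /andP[t0 _].
by rewrite hornerX powRr1 // subrr normr0.
Qed.

Variables (A B : {linear H -> H}).
Hypotheses (bA : bounded_op A) (bB : bounded_op B)
  (AB : forall x y, rip (A x) y = rip x (B y)).
Local Notation P := (B \o A : {linear H -> H}).
Local Notation Q := (A \o B : {linear H -> H}).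

Lemma quasinormal_phyp p n : 0 < p -> phyp dot A B p -> (3 <= n)%N ->
  iter n B \o iter n A = iter n (B \o A) -> A \o (B \o A) = (B \o A) \o A.
Proof.
move=> p0 hp n3 hn; apply/funext => x /=; apply/esym.
have [q q01 hq] := phyp_le1 Hdot bA bB AB p0 hp.
apply: (quasinormal_of_moments Hdot bA bB AB (phyp_paranormal Hdot bA bB AB q01 hq) n3) => y.
by rewrite -[moment A B n y]/((iter n B \o iter n A) y) hn.
Qed.

(** S_3 is out of reach here. Instead the form of P - Q at A x is <S_2 x, x> - <P^2 x, x> = 0, and a
    positive operator kills every vector on which its form vanishes. *)
Lemma quasinormal_hypo2 : phyp dot A B 1 ->
  iter 2 B \o iter 2 A = iter 2 (B \o A) -> A \o (B \o A) = (B \o A) \o A.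
Proof.
move=> hp h2; apply/funext => x /=.
have [sP sQ] := (P_sym AB, Q_sym AB).
have [bP bQ] := (P_bounded bA bB, Q_bounded bA bB).
pose Z y := P y - Q y.
have sZ : symop dot Z by move=> y z; rewrite /Z !ripE sP sQ.
have Z_ge0 y : 0 <= rip (Z y) y.
  have := hp y; rewrite (op_pow1 sP (P_ge0 Hdot AB) bP) (op_pow1 sQ (Q_ge0 Hdot AB) bQ).
  by rewrite /Z !ripE subr_ge0.
have [[K0 hK] [L0 hL]] := (opnormP bP, opnormP bQ).
have hZ y : rnorm (Z y) <= (opnorm P + opnorm Q) * rnorm y.
  by apply: le_trans (rnormB _ _) _; rewrite mulrDl lerD.
have ZA : rip (Z (A x)) (A x) = 0.
  rewrite /Z !ripE -!(adj_sym AB) -[B (P (A x))]/((iter 2 B \o iter 2 A) x) h2.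
  by rewrite -[B (Q (A x))]/(iter 2 P x) subrr.
have := pos_CS Hdot sZ Z_ge0 (addr_ge0 K0 L0) hZ (A x).
rewrite ZA mulr0 -(ripxx Hdot) => h; apply/eqP; rewrite eq_sym -subr_eq0; apply/eqP.
by apply: (rip_eq0 Hdot); apply/eqP; rewrite eq_le h rip_ge0.
Qed.

End Hypo.

Lemma linear_adjoint (R : realType) (H : completeNormedModType R[i])
    (dot : {dot H for Num.Def.conjC}) (Hdot : hilbert_norm dot) (A : {linear H -> H}) :
  bounded_op A -> exists B : {linear H -> H},
  [/\ adjoint dot A = B :> (H -> H), bounded_op B & forall x y, redot dot (A x) y = redot dot x (B y)].
Proof.
move=> bA; have adj := adjointE Hdot bA; set B := adjoint dot A in adj *.
have AB x y : redot dot (A x) y = redot dot x (B y) by rewrite /redot adj.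
have linB : linear B.
  move=> c x y; apply/eqP; rewrite -subr_eq0 -(dnorm_eq0 dot).
  apply/eqP; set z := _ - _; rewrite {2}/z linearBr linearDr linearZr_LR /=.
  by rewrite -!adj linearDr linearZr_LR /= subrr.
pose B' : {linear H -> H} := HB.pack B (GRing.isLinear.Build _ _ _ _ B linB).
exists B'; split=> //.
have [M M0 hM] := boundedP bA; exists M => x; rewrite !rnormE -rmorphM lecR /=.
have [->|n0] := eqVneq (rnorm (B x)) 0; first by rewrite mulr_ge0 ?rnorm_ge0.
have {}n0 : 0 < rnorm (B x) by rewrite lt_def n0 rnorm_ge0.
rewrite -(ler_pM2r n0) -expr2 -(ripxx Hdot) -AB.
apply: le_trans (ler_norm _) _; apply: le_trans (rip_le Hdot _ _) _.
by rewrite mulrAC ler_wpM2r ?rnorm_ge0.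
Qed.

Theorem theorem5p3 (R : realType) (H : completeNormedModType R[i])
    (dot : {dot H for Num.Def.conjC}) (Hdot : hilbert_norm dot) :
  (forall (m n : nat) (p : R) (A : {linear H -> H}),
      (0 < m)%N -> (0 < n)%N ->
      bounded_op A ->
      m%:R - 1 < p -> p <= m%:R ->
      p_hyponormal dot p A ->
      iter n (adjoint dot A) \o iter n A = iter n (adjoint dot A \o A) ->
      (m + 3 <= n)%N ->
      quasinormal dot A) /\
  (forall A : {linear H -> H},
      bounded_op A ->
      hyponormal dot A ->
      (exists2 k : nat, (2 <= k)%N &
        iter k (adjoint dot A) \o iter k A = iter k (adjoint dot A \o A)) ->
      quasinormal dot A).
Proof.
have phypE p (A B : {linear H -> H}) : adjoint dot A = B :> (H -> H) ->
    p_hyponormal dot p A -> phyp dot A B p.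
  rewrite /p_hyponormal => -> hp x; have := hp x; rewrite lecE => /andP[_] /=.
  by rewrite -/(redot dot _ _) !ripE subr_ge0.
split=> [m n p A m0 _ bA mp _ hp hn mn|A bA hp [k k2 hk]].
- have [B [EB bB AB]] := linear_adjoint Hdot bA.
  have p0 : 0 < p by apply: le_lt_trans mp; rewrite subr_ge0 ler1n.
  rewrite /quasinormal EB; rewrite EB in hn.
  by apply: (quasinormal_phyp Hdot bA bB AB p0 (phypE _ _ _ EB hp) _ hn); lia.
- have [B [EB bB AB]] := linear_adjoint Hdot bA.
  rewrite /quasinormal EB; rewrite EB in hk.
  (* From k = 3 on the moment argument applies with p = 1; k = 2 is the separate case. *)
  have [k3|] := ltnP 2 k; first exact: (quasinormal_phyp Hdot bA bB AB ltr01 (phypE _ _ _ EB hp) k3 hk).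
  move=> k2'; have kE : k = 2 by apply/eqP; rewrite eqn_leq k2' k2.
  by rewrite kE in hk; exact: (quasinormal_hypo2 Hdot bA bB AB (phypE _ _ _ EB hp) hk).
Qed.
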